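(* Let $k$ be a field of characteristic $0$. Suppose the Artinian Berger Conjecture holds over $k$, i.e. for every finite commutative $k$-algebra $A$ one has $\tau(A)=0$ if and only if $A$ is a tame principal ideal algebra. Then Berger's Conjecture holds over $k$: if $R$ is a reduced finitely generated commutative $k$-algebra of pure dimension one which is not regular, then the torsion submodule of $\Omega_{R/k}$ is nonzero.
   Context: All algebras are commutative $k$-algebras, and $\Omega_A$ denotes the module of Kähler differentials $\Omega_{A/k}$. A finite algebra is one that is finite-dimensional over $k$. A principal ideal algebra is a finite commutative $k$-algebra in which every ideal is principal; every such algebra is a finite product of truncated polynomial rings $K_i[s]/(s^{n_i})$ with $K_i$ finite field extensions of $k$. A truncated polynomial ring $K[s]/(s^n)$ ($K$ a finite extension of $k$) is tame if $\operatorname{char}K=0$, or $\operatorname{char}K=p>0$ and $p\nmid n$; a principal ideal algebra is tame if it is a product of tame truncated polynomial rings. For a finite $k$-algebra $A$, $\tau(A)\subseteq\Omega_A$ is the intersection of the kernels of the induced maps $f_*:\Omega_A\to\Omega_B$ over all $k$-algebra homomorphisms $f:A\to B$ with $B$ a tame principal ideal algebra. *)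

(* Defs.v *)
From HB Require Import structures.
From mathcomp Require Import all_boot all_order all_algebra.
Set Implicit Arguments. Unset Strict Implicit. Unset Printing Implicit Defensive.
Import Order.TTheory GRing.Theory Num.Theory.
Local Open Scope ring_scope.

Section Defs.
Variable k : fieldType.

(* An element of the free A-module on the symbols [d b] (b : A) is represented
   by a finite formal sum  s = sum_i a_i [d b_i],  s : seq (A * A) with pairs
   (a_i, b_i).  Its coefficient at the symbol [d b]: *)
Definition fcoef (A : comAlgType k) (s : seq (A * A)) (b : A) : A :=
  \sum_(p <- s | p.2 == b) p.1.

(* kd_null s  <->  s lies in the submodule generated by the relations
   d(b+c) - db - dc,  d(bc) - b dc - c db,  d(lambda 1) (lambda in k),
   i.e. s represents 0 in Omega_{A/k}. *)
Inductive kd_null (A : comAlgType k) : seq (A * A) -> Prop :=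
| kdn_nil : kd_null [::]
| kdn_add a b c s : kd_null s ->
    kd_null ((a, b + c) :: (- a, b) :: (- a, c) :: s)
| kdn_mul a b c s : kd_null s ->
    kd_null ((a, b * c) :: (- (a * b), c) :: (- (a * c), b) :: s)
| kdn_const a (l : k) s : kd_null s -> kd_null ((a, l%:A) :: s)
| kdn_eq s t : kd_null s -> (forall b, fcoef s b = fcoef t b) -> kd_null t.

Definition dmap (A B : comAlgType k) (f : A -> B) (s : seq (A * A)) :
  seq (B * B) := [seq (f p.1, f p.2) | p <- s].

Definition dscale (A : comAlgType k) (r : A) (s : seq (A * A)) :
  seq (A * A) := [seq (r * p.1, p.2) | p <- s].

Definition is_ideal (A : comAlgType k) (I : A -> Prop) : Prop :=
  I 0 /\ (forall x y, I x -> I y -> I (x + y)) /\ (forall r x, I x -> I (r * x)).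

Definition principal (A : comAlgType k) (I : A -> Prop) : Prop :=
  exists g, forall x, I x <-> exists y, x = y * g.

Definition finite_alg (A : comAlgType k) : Prop :=
  exists n (v : 'I_n -> A), forall a, exists c : 'I_n -> k,
    a = \sum_(i < n) c i *: v i.

Definition PIA (A : comAlgType k) : Prop :=
  finite_alg A /\ forall I : A -> Prop, is_ideal I -> principal I.

Definition idempotent (A : comAlgType k) (e : A) : Prop := e * e = e.

Definition primitive_idem (A : comAlgType k) (e : A) : Prop :=
  idempotent e /\ e != 0 /\
  forall f, idempotent f -> f * e = f -> f = 0 \/ f = e.

Definition nilpotent_el (A : comAlgType k) (x : A) : Prop :=
  exists n : nat, x ^+ n = 0.

(* Tame principal ideal algebra.  A PIA A is the product of its local factors
   eA (e a primitive idempotent), each isomorphic to K[s]/(s^n) with K a finite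
   extension of k (so char K = char k); n is the nilpotency index of any
   generator x of the maximal (= nil) ideal of eA.  Tameness: whenever
   char k = p > 0, p does not divide any such n. *)
Definition tame_PIA (A : comAlgType k) : Prop :=
  PIA A /\
  forall p : nat, p \in [pchar k] ->
  forall e : A, primitive_idem e ->
  forall x : A, x = e * x -> nilpotent_el x ->
    (forall y, y = e * y -> nilpotent_el y -> exists z, y = z * x) ->
  forall n : nat, x ^+ n = 0 -> x ^+ n.-1 != 0 -> ~~ (p %| n)%N.

Definition tau_trivial (A : comAlgType k) : Prop :=
  forall s : seq (A * A),
    (forall (B : comAlgType k) (f : {lrmorphism A -> B}),
        tame_PIA B -> kd_null (dmap f s)) ->
    kd_null s.

Definition artinian_berger : Prop :=
  forall A : comAlgType k, finite_alg A -> (tau_trivial A <-> tame_PIA A).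

Definition reduced (R : comAlgType k) : Prop :=
  forall (x : R) (n : nat), x ^+ n = 0 -> x = 0.

Definition fin_gen (R : comAlgType k) : Prop :=
  exists n (g : 'I_n -> R), forall S : R -> Prop,
    (forall l : k, S l%:A) -> (forall x y, S x -> S y -> S (x + y)) ->
    (forall x y, S x -> S y -> S (x * y)) -> (forall i, S (g i)) ->
    forall r, S r.

Definition prime_ideal (R : comAlgType k) (P : R -> Prop) : Prop :=
  is_ideal P /\ ~ P 1 /\ forall x y, P (x * y) -> P x \/ P y.

Definition maximal_ideal (R : comAlgType k) (M : R -> Prop) : Prop :=
  is_ideal M /\ ~ M 1 /\
  forall I : R -> Prop, is_ideal I -> (forall x, M x -> I x) ->
    (forall x, I x <-> M x) \/ (forall x, I x).

Definition strict_sub (R : comAlgType k) (P Q : R -> Prop) : Prop :=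
  (forall x, P x -> Q x) /\ exists x, Q x /\ ~ P x.

Definition minimal_prime (R : comAlgType k) (P : R -> Prop) : Prop :=
  prime_ideal P /\ ~ exists Q, prime_ideal Q /\ strict_sub Q P.

Definition coheight_one (R : comAlgType k) (P : R -> Prop) : Prop :=
  (exists Q, prime_ideal Q /\ strict_sub P Q) /\
  ~ (exists Q1 Q2, prime_ideal Q1 /\ prime_ideal Q2 /\
        strict_sub P Q1 /\ strict_sub Q1 Q2).

Definition pure_dim_one (R : comAlgType k) : Prop :=
  forall P : R -> Prop, minimal_prime P -> coheight_one P.

Definition height_ge (R : comAlgType k) (P : R -> Prop) (n : nat) : Prop :=
  exists c : nat -> R -> Prop,
    (forall i, (i <= n)%N -> prime_ideal (c i)) /\
    (forall i, (i < n)%N -> strict_sub (c i) (c i.+1)) /\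
    (forall x, c n x <-> P x).

Definition height_eq (R : comAlgType k) (P : R -> Prop) (n : nat) : Prop :=
  height_ge P n /\ ~ height_ge P n.+1.

(* m/m^2 is spanned over R/m by the images of r elements of m, i.e.
   m is contained in (x_1,...,x_r) + m^2 *)
Definition edim_le (R : comAlgType k) (M : R -> Prop) (r : nat) : Prop :=
  exists x : 'I_r -> R, (forall i, M (x i)) /\
  forall y, M y -> exists (c : 'I_r -> R) (s : seq (R * R)),
     (forall q, q \in s -> M q.1 /\ M q.2) /\
     y = \sum_(i < r) c i * x i + \sum_(q <- s) q.1 * q.2.

Definition edim_eq (R : comAlgType k) (M : R -> Prop) (r : nat) : Prop :=
  edim_le M r /\ forall r', edim_le M r' -> (r <= r')%N.

(* R_m is a regular local ring: dim R_m (= ht m) = dim_{R/m} m/m^2 *)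
Definition regular_at (R : comAlgType k) (M : R -> Prop) : Prop :=
  exists r, height_eq M r /\ edim_eq M r.

Definition regular_ring (R : comAlgType k) : Prop :=
  forall M : R -> Prop, maximal_ideal M -> regular_at M.

Definition nonzerodivisor (R : comAlgType k) (r : R) : Prop :=
  forall y, r * y = 0 -> y = 0.

Definition omega_torsion_nonzero (R : comAlgType k) : Prop :=
  exists s : seq (R * R), ~ kd_null s /\
    exists r, nonzerodivisor r /\ kd_null (dscale r s).

End Defs.

(* Main.v *)
(* Assume that Omega_R is torsion-free and let M be a maximal ideal of R. By
   Noether normalization R is a finite free module over a polynomial ring k[x],
   and since R is reduced of characteristic 0 the discriminant of its trace form
   bounds the denominators of the integral closure S of R. Choose c in k[x] with
   c S contained in R and c^2 S in R contained in M^2, and let J be the radical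
   of c S. Since S is integrally closed, J is invertible, hence J = t S + c^m S
   for some t and all m. Put I = J^N = t^N S + c^(2N) S with N large, so that I
   is an ideal of both R and S. The algebra S / I has a principal nilradical, so
   it is a (tame) principal ideal algebra. In characteristic 0 forms can be
   integrated: I Omega_S is contained in d I + I^2 Omega_S, hence in
   d I + I Omega_R. As Omega_R embeds in Omega_S, Omega_(R/I) embeds in
   Omega_(S/I), so tau(R/I) = 0. By the Artinian Berger Conjecture R/I is a
   principal ideal algebra, so M is generated by one element modulo I, hence
   modulo M^2, and R is regular at M. *)
Require Import Defs.
From HB Require Import structures.
From mathcomp Require Import all_boot all_order all_algebra all_field mpoly.
From mathcomp Require Import boolp classical_sets.
From mathcomp Require Import ring.
Set Implicit Arguments. Unset Strict Implicit. Unset Printing Implicit Defensive.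
Import GRing.Theory.
Local Open Scope ring_scope.
Local Open Scope quotient_scope.

(** * Quotient algebras *)


(** No localization is formed. The closure S is represented by numerators over one fixed
    denominator, the discriminant d, and identities are proved after multiplication by nonzero
    polynomials in x, which are nonzerodivisors because R is reduced of pure dimension one.
    Integrality over R takes the form of bounded denominators of powers ([almost_int]), a condition
    that passes directly to determinants over k[x]. The element c is d p with p in k[x] and h p in
    M: the factor d brings c S into R, and p brings the elements of R in c^2 S into M^2. Local
    factors of finite algebras are handled through the idempotents of Fitting's argument. The
    exponent 2N comes from the form argument: c^N lies in I, so c^(2N) is a product of two elements
    of I, and a form x y df with x, y in I comes from R. Torsion-freeness enters through a map
    Omega_S -> Omega_R, defined by the quotient rule, that inverts Omega_R -> Omega_S up to a power
    of d. *)

Section QuotientAlgebra.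
Variables (k : fieldType) (A : comAlgType k) (I : A -> Prop).
Hypotheses (idI : is_ideal I) (I1 : ~ I 1).

(** Classical reflection gives the ideal the boolean form on which ring quotients are built; [I1]
    makes the quotient a nonzero ring. *)
Definition ideal_pred : {pred A} := fun x => `[< I x >].

Lemma ideal_predE x : (x \in ideal_pred) = `[< I x >]. Proof. by []. Qed.

Lemma ideal_pred_closed : idealr_closed ideal_pred.
Proof.
case: idI => I0 [ID IM]; split; rewrite ?ideal_predE; first exact/asboolP.
  by apply/negP => /asboolP.
move=> a u v; rewrite !ideal_predE => /asboolP Iu /asboolP Iv.
by apply/asboolP/ID => //; apply: IM.
Qed.

HB.instance Definition _ := isIdealr.Build A ideal_pred ideal_pred_closed.

Definition qalg := {ideal_quot ideal_pred : idealr A}.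
HB.instance Definition _ := GRing.ComNzRing.on qalg.

Definition qpi (x : A) : qalg := \pi x.

Lemma qpi_is_zmod : zmod_morphism qpi.
Proof. by move=> x y; rewrite /qpi rmorphB. Qed.
Lemma qpi_is_monoid : monoid_morphism qpi.
Proof. by split=> [|x y]; rewrite /qpi ?rmorph1 ?rmorphM. Qed.

HB.instance Definition _ := GRing.isZmodMorphism.Build A qalg qpi qpi_is_zmod.
HB.instance Definition _ := GRing.isMonoidMorphism.Build A qalg qpi qpi_is_monoid.

Definition qscale (a : k) (x : qalg) : qalg := qpi a%:A * x.

Lemma qscaleA a b x : qscale a (qscale b x) = qscale (a * b) x.
Proof. by rewrite /qscale mulrA -rmorphM -scalerAl mul1r scalerA. Qed.
Lemma qscale1 : left_id 1 qscale.
Proof. by move=> x; rewrite /qscale scale1r rmorph1 mul1r. Qed.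
Lemma qscaleDr : right_distributive qscale +%R.
Proof. by move=> a x y; rewrite /qscale mulrDr. Qed.
Lemma qscaleDl x : {morph qscale^~ x : a b / a + b}.
Proof. by move=> a b; rewrite /qscale scalerDl rmorphD mulrDl. Qed.

HB.instance Definition _ :=
  GRing.Zmodule_isLmodule.Build k qalg qscaleA qscale1 qscaleDr qscaleDl.

Lemma qscaleAl (a : k) (u v : qalg) : a *: (u * v) = (a *: u) * v.
Proof. by rewrite /GRing.scale /= /qscale mulrA. Qed.
HB.instance Definition _ := GRing.Lmodule_isLalgebra.Build k qalg qscaleAl.
HB.instance Definition _ := GRing.Lalgebra_isComAlgebra.Build k qalg.

Lemma qpi_scalable : scalable qpi.
Proof. by move=> a x; rewrite /GRing.scale /= /qscale -rmorphM mulr_algl. Qed.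
HB.instance Definition _ := GRing.isScalable.Build k A qalg *:%R qpi qpi_scalable.

Lemma qpi_surj (q : qalg) : exists a, qpi a = q.
Proof. by exists (repr q); rewrite /qpi reprK. Qed.

Lemma qpi_eq0 a : qpi a = 0 <-> I a.
Proof.
have E : (qpi a == 0) = `[< I a >].
  by rewrite -(rmorph0 qpi) /qpi -Quotient.idealrBE subr0.
split=> [/eqP|/asboolP]; first by rewrite E => /asboolP.
by rewrite -E => /eqP.
Qed.

End QuotientAlgebra.

(** Only the surjection and its kernel matter afterwards, so the carrier of the quotient is hidden
    here. *)
Lemma quotient_alg (k : fieldType) (A : comAlgType k) (I : A -> Prop) :
  is_ideal I -> ~ I 1 ->
  exists (Q : comAlgType k) (pi : {lrmorphism A -> Q}),
    (forall q, exists a, pi a = q) /\ forall a, pi a = 0 <-> I a.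
Proof.
move=> idI I1; exists (qalg idI I1 : comAlgType k), (@qpi k A I idI I1 : {lrmorphism _ -> _}).
by split; [exact: qpi_surj | exact: qpi_eq0].
Qed.

(** * Kaehler differentials *)


Section Kaehler.
Variables (k : fieldType) (A : comAlgType k).
Implicit Types s t u : seq (A * A).

Definition kopp s := [seq (- p.1, p.2) | p <- s].

Lemma fcoef_nil (b : A) : fcoef [::] b = 0.
Proof. by rewrite /fcoef big_nil. Qed.

Lemma fcoef_cons (p : A * A) s b :
  fcoef (p :: s) b = (if p.2 == b then p.1 else 0) + fcoef s b.
Proof. by rewrite /fcoef big_cons; case: ifP; rewrite ?add0r. Qed.

Lemma fcoef_cat s t b : fcoef (s ++ t) b = fcoef s b + fcoef t b.
Proof. by rewrite /fcoef big_cat. Qed.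

Lemma fcoef_opp s b : fcoef (kopp s) b = - fcoef s b.
Proof. by rewrite /fcoef big_map /= sumrN. Qed.

Lemma fcoef_scale r s b : fcoef (dscale r s) b = r * fcoef s b.
Proof. by rewrite /fcoef big_map /= mulr_sumr. Qed.

Definition fcoefE := (fcoef_nil, fcoef_cons, fcoef_cat, fcoef_opp, fcoef_scale).

Lemma kd_cat s t : kd_null s -> kd_null t -> kd_null (s ++ t).
Proof.
move=> Hs; elim: Hs t => {s} //=.
- by move=> a b c s _ IH t /IH; apply: kdn_add.
- by move=> a b c s _ IH t /IH; apply: kdn_mul.
- by move=> a l s _ IH t /IH; apply: kdn_const.
move=> s s' _ IH e t /IH H; apply: kdn_eq H _ => b.
by rewrite !fcoef_cat e.
Qed.

Lemma kd_scale r s : kd_null s -> kd_null (dscale r s).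
Proof.
elim=> {s} //=.
- exact: kdn_nil.
- by move=> a b c s _ IH; rewrite !mulrN; apply: kdn_add.
- by move=> a b c s _ IH; rewrite !mulrN !mulrA; apply: kdn_mul.
- by move=> a l s _ IH; apply: kdn_const.
by move=> s s' _ IH e; apply: kdn_eq IH _ => b; rewrite !fcoefE e.
Qed.

Lemma kd_fcoef0 s : (forall b, fcoef s b = 0) -> kd_null s.
Proof. by move=> e; apply: kdn_eq (kdn_nil A) _ => b; rewrite fcoef_nil e. Qed.

(** The quotient by this relation is a true A-module [omega], in which manipulations of formal sums
    become linear algebra. *)
Definition keq : rel (seq (A * A)) := fun s t => `[< kd_null (s ++ kopp t) >].

Lemma keq_equiv : equiv_class_of keq.
Proof.
have sy s t : keq s t -> keq t s.
  move/asboolP => H; apply/asboolP.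
  by apply: kdn_eq (kd_scale (-1) H) _ => b; rewrite !fcoefE; ring.
split=> [s|s t|t s u].
- by apply/asboolP/kd_fcoef0 => b; rewrite !fcoefE subrr.
- by apply/idP/idP; apply: sy.
move=> /asboolP H1 /asboolP H2; apply/asboolP.
by apply: kdn_eq (kd_cat H1 H2) _ => b; rewrite !fcoefE; ring.
Qed.

Canonical keq_equivRel := EquivRelPack keq_equiv.
Canonical keq_encModRel := defaultEncModRel keq.

Definition omega := {eq_quot keq}.
HB.instance Definition _ := Choice.on omega.
HB.instance Definition _ := EqQuotient.on omega.

Definition om s : omega := \pi s.

Lemma omP s t : om s = om t <-> kd_null (s ++ kopp t).
Proof.
by split=> [/eqP|/asboolP H]; last (apply/eqP; move: H); rewrite piE => /asboolP //.
Qed.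

Lemma om_surj (x : omega) : exists s, x = om s.
Proof. by exists (repr x); rewrite /om reprK. Qed.

Definition oadd (x y : omega) := om (repr x ++ repr y).
Definition oopp (x : omega) := om (kopp (repr x)).
Definition oscale r (x : omega) := om (dscale r (repr x)).

Lemma om_repr s : kd_null (repr (om s) ++ kopp s).
Proof. by apply/omP; rewrite /om reprK. Qed.

Lemma oaddE s t : oadd (om s) (om t) = om (s ++ t).
Proof.
apply/omP; apply: kdn_eq (kd_cat (om_repr s) (om_repr t)) _ => b.
by rewrite !fcoefE; ring.
Qed.

Lemma oscaleE r s : oscale r (om s) = om (dscale r s).
Proof.
by apply/omP; apply: kdn_eq (kd_scale r (om_repr s)) _ => b; rewrite !fcoefE; ring.
Qed.

Lemma ooppE s : oopp (om s) = om (kopp s).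
Proof.
by apply/omP; apply: kdn_eq (kd_scale (-1) (om_repr s)) _ => b; rewrite !fcoefE; ring.
Qed.

Lemma om_fcoef s t : (forall b, fcoef s b = fcoef t b) -> om s = om t.
Proof. by move=> e; apply/omP/kd_fcoef0 => b; rewrite !fcoefE e subrr. Qed.

Lemma oaddA : associative oadd.
Proof.
move=> x y z; case: (om_surj x) (om_surj y) (om_surj z) => s -> [t ->] [u ->].
by rewrite !oaddE catA.
Qed.
Lemma oaddC : commutative oadd.
Proof.
move=> x y; case: (om_surj x) (om_surj y) => s -> [t ->].
by rewrite !oaddE; apply: om_fcoef => b; rewrite !fcoefE addrC.
Qed.
Lemma oadd0 : left_id (om [::]) oadd.
Proof. by move=> x; case: (om_surj x) => s ->; rewrite oaddE. Qed.
Lemma oaddN : left_inverse (om [::]) oopp oadd.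
Proof.
move=> x; case: (om_surj x) => s ->; rewrite ooppE oaddE.
by apply: om_fcoef => b; rewrite !fcoefE addNr.
Qed.
HB.instance Definition _ := GRing.isZmodule.Build omega oaddA oaddC oadd0 oaddN.

Lemma omD s t : om s + om t = om (s ++ t). Proof. exact: oaddE. Qed.

Lemma oscaleA a b x : oscale a (oscale b x) = oscale (a * b) x.
Proof.
case: (om_surj x) => s ->; rewrite !oscaleE.
by apply: om_fcoef => c; rewrite !fcoefE mulrA.
Qed.
Lemma oscale1 : left_id 1 oscale.
Proof.
move=> x; case: (om_surj x) => s ->; rewrite !oscaleE.
by apply: om_fcoef => c; rewrite !fcoefE mul1r.
Qed.
Lemma oscaleDr : right_distributive oscale +%R.
Proof.
move=> a x y; case: (om_surj x) (om_surj y) => s -> [t ->].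
rewrite omD !oscaleE omD.
by apply: om_fcoef => c; rewrite !fcoefE mulrDr.
Qed.
Lemma oscaleDl x : {morph oscale^~ x : a b / a + b}.
Proof.
move=> a b; case: (om_surj x) => s ->; rewrite !oscaleE omD.
by apply: om_fcoef => c; rewrite !fcoefE mulrDl.
Qed.
HB.instance Definition _ :=
  GRing.Zmodule_isLmodule.Build A omega oscaleA oscale1 oscaleDr oscaleDl.

Definition dif (b : A) : omega := om [:: (1, b)].

Definition osum s : omega := \sum_(p <- s) p.1 *: dif p.2.

Lemma om_sum s : om s = osum s.
Proof.
elim: s => [|p s IH]; first by rewrite /osum big_nil.
rewrite /osum big_cons -/(osum s) -IH {1}/dif [p.1 *: _]oscaleE omD.
by apply: om_fcoef => b; rewrite !fcoefE /=; case: ifP => _; ring.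
Qed.

Lemma osum0 s : osum s = 0 <-> kd_null s.
Proof.
rewrite -om_sum; have -> : (0 : omega) = om [::] by [].
split=> [/omP H|H]; last apply/omP; apply: kdn_eq H _ => b; rewrite !fcoefE;
  by rewrite oppr0 addr0.
Qed.

Lemma osum_surj (x : omega) : exists s, x = osum s.
Proof. by case: (om_surj x) => s ->; exists s; rewrite om_sum. Qed.

Lemma difD (b c : A) : dif (b + c) = dif b + dif c.
Proof.
have /osum0 := kdn_add 1 b c (kdn_nil A).
rewrite /osum !big_cons big_nil /= addr0 !scaleNr !scale1r => /eqP.
by rewrite addrA -addrA -opprD subr_eq0 => /eqP.
Qed.

Lemma difM (b c : A) : dif (b * c) = b *: dif c + c *: dif b.
Proof.
have /osum0 := kdn_mul 1 b c (kdn_nil A).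
rewrite /osum !big_cons big_nil /= addr0 !scaleNr !mul1r !scale1r => /eqP.
by rewrite addrA -addrA -opprD subr_eq0 => /eqP.
Qed.

Lemma dif_const (l : k) : dif l%:A = 0.
Proof.
have /osum0 := kdn_const 1 l (kdn_nil A).
by rewrite /osum !big_cons big_nil /= addr0 scale1r.
Qed.

Lemma difZ (l : k) (b : A) : dif (l *: b) = l%:A *: dif b.
Proof. by rewrite -[l *: b]mulr_algl difM dif_const scaler0 addr0. Qed.

Lemma dif_is_zmod : zmod_morphism dif.
Proof.
move=> x y; rewrite difD; congr (_ + _).
by rewrite -scaleN1r difZ scaleN1r scaleNr scale1r.
Qed.
HB.instance Definition _ := GRing.isZmodMorphism.Build A omega dif dif_is_zmod.

Lemma difX (b : A) n : dif (b ^+ n) = (n%:R * b ^+ n.-1) *: dif b.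
Proof.
elim: n => [|n IH]; first by rewrite mul0r scale0r expr0; move: (dif_const 1); rewrite scale1r.
rewrite exprS difM IH scalerA -scalerDl; congr (_ *: _).
case: n {IH} => [|n] /=; first by rewrite mul0r mulr0 add0r mul1r.
by rewrite [in RHS]mulrSr mulrDl mul1r mulrCA -exprS.
Qed.

End Kaehler.

(** Universal property of the differentials, with [phi a b] as the image of a db. The target is a
    plain abelian group, so that [relquot] and differentials of another ring both fit. *)
Lemma kd_sum0 (k : fieldType) (A : comAlgType k) (V : zmodType) (phi : A -> A -> V) :
  (forall a a' b, phi (a + a') b = phi a b + phi a' b) ->
  (forall a b c, phi a (b + c) = phi a b + phi a c) ->
  (forall a b c, phi a (b * c) = phi (a * b) c + phi (a * c) b) ->
  (forall a (l : k), phi a l%:A = 0) ->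
  forall s, kd_null s -> \sum_(p <- s) phi p.1 p.2 = 0.
Proof.
move=> DL DR L C.
have phi0 b : phi 0 b = 0 by apply: (addrI (phi 0 b)); rewrite -DL !addr0.
have phiN a b : phi (- a) b = - phi a b.
  by apply/eqP; rewrite -addr_eq0 -DL addNr phi0.
(* Since [kdn_eq] compares coefficients only, the sum is regrouped by symbols over a duplicate-free
   list containing all of them. *)
have E s (u : seq A) : uniq u -> {subset [seq p.2 | p <- s] <= u} ->
    \sum_(p <- s) phi p.1 p.2 = \sum_(b <- u) phi (fcoef s b) b.
  move=> Uu; elim: s => [|p s IH] su.
    by rewrite big_nil big1 // => b _; rewrite fcoef_nil phi0.
  rewrite big_cons IH => [|x xs]; last by apply: su; rewrite inE xs orbT.
  have pu : p.2 \in u by apply: su; rewrite inE eqxx.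
  rewrite [RHS](eq_bigr (fun b => (if b == p.2 then phi p.1 p.2 else 0) + phi (fcoef s b) b)).
    rewrite big_split /= -big_mkcond /=; congr (_ + _).
    by rewrite -big_filter filter_pred1_uniq // big_seq1.
  move=> b _; rewrite fcoef_cons DL; congr (_ + _).
  by rewrite eq_sym; case: eqP => [->|_].
move=> s; elim=> {s} [|a b c s _ IH|a b c s _ IH|a l s _ IH|s t _ IH e].
- by rewrite big_nil.
- by rewrite !big_cons /= IH !phiN DR addr0 addrA -addrA -opprD subrr.
- by rewrite !big_cons /= IH !phiN L addr0 addrA -addrA -opprD subrr.
- by rewrite big_cons IH C addr0.
rewrite -[RHS]IH; pose u := undup ([seq p.2 | p <- s] ++ [seq p.2 | p <- t]).
have su : {subset [seq p.2 | p <- s] <= u}.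
  by move=> x; rewrite mem_undup mem_cat => ->.
have tu : {subset [seq p.2 | p <- t] <= u}.
  by move=> x; rewrite mem_undup mem_cat orbC => ->.
rewrite (E _ _ (undup_uniq _) su) (E _ _ (undup_uniq _) tu).
by apply: eq_bigr => b _; rewrite e.
Qed.

(** * Functoriality and quotients of Kaehler differentials *)

Section Push.
Variables (k : fieldType) (A B : comAlgType k) (f : {lrmorphism A -> B}).

Lemma osum_dmap s : osum (dmap f s) = \sum_(p <- s) f p.1 *: dif (f p.2).
Proof. by rewrite /osum big_map. Qed.

Lemma kd_dmap s : kd_null s -> kd_null (dmap f s).
Proof.
move=> H; apply/osum0; rewrite osum_dmap.
apply: (kd_sum0 (phi := fun a b => f a *: dif (f b))) H.
- by move=> a a' b; rewrite rmorphD scalerDl.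
- by move=> a b c; rewrite rmorphD difD scalerDr.
- by move=> a b c; rewrite !rmorphM difM scalerDr !scalerA.
- by move=> a l; rewrite linearZ /= rmorph1 dif_const scaler0.
Qed.

Definition opush (w : omega A) : omega B := osum (dmap f (repr w)).

Lemma osum_cat s t : osum (s ++ t) = osum s + osum t :> omega A.
Proof. by rewrite /osum big_cat. Qed.

Lemma osum_opp s : osum (kopp s) = - osum s :> omega A.
Proof.
by rewrite /osum big_map /= -sumrN; apply: eq_bigr => p _; rewrite scaleNr.
Qed.

Lemma osum_scale r s : osum (dscale r s) = r *: osum s :> omega A.
Proof.
by rewrite /osum big_map /= scaler_sumr; apply: eq_bigr => p _; rewrite scalerA.
Qed.
End Push.

Lemma opushE (k : fieldType) (A B : comAlgType k) (f : {lrmorphism A -> B}) s :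
  opush f (osum s) = osum (dmap f s).
Proof.
rewrite /opush; set t := repr _.
have /(kd_dmap f)/osum0 : kd_null (t ++ kopp s).
  apply/osum0; rewrite osum_cat osum_opp.
  by rewrite -[osum t]om_sum /om reprK subrr.
rewrite /dmap map_cat osum_cat -!map_comp => /eqP.
rewrite addr_eq0 => /eqP ->; rewrite -osum_opp /kopp -!map_comp.
by congr (osum _); apply: eq_map => p /=; rewrite rmorphN opprK.
Qed.

Section PushTheory.
Variables (k : fieldType) (A B : comAlgType k) (f : {lrmorphism A -> B}).

Lemma opushD v w : opush f (v + w) = opush f v + opush f w.
Proof.
case: (osum_surj v) (osum_surj w) => s -> [t ->].
by rewrite -osum_cat !opushE /dmap map_cat osum_cat.
Qed.

Lemma opushZ a w : opush f (a *: w) = f a *: opush f w.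
Proof.
case: (osum_surj w) => s ->; rewrite -osum_scale !opushE -osum_scale.
rewrite /dmap /dscale -!map_comp.
by congr (osum _); apply: eq_map => p /=; rewrite rmorphM.
Qed.

Lemma opush_dif b : opush f (dif b) = dif (f b).
Proof.
have e (C : comAlgType k) (c : C) : dif c = osum [:: (1, c)].
  by rewrite /osum big_seq1 scale1r.
by rewrite !e opushE /= rmorph1.
Qed.

Lemma opushN w : opush f (- w) = - opush f w.
Proof. by rewrite -scaleN1r opushZ rmorphN rmorph1 scaleN1r. Qed.
End PushTheory.

(* [relform I] is the kernel I Omega + dI of Omega_A -> Omega_{A/I}. *)
Definition relform (k : fieldType) (A : comAlgType k) (I : A -> Prop) (w : omega A) : Prop :=
  exists z s, [/\ I z, forall p, p \in s -> I p.1 & w = dif z + osum s].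

Section QuotientForms.
Variables (k : fieldType) (A : comAlgType k) (I : A -> Prop).
Hypothesis idI : is_ideal I.

Lemma is_idealN x : I x -> I (- x).
Proof. by case: idI => _ [_ IM] Ix; rewrite -mulN1r; apply: IM. Qed.

Lemma relform0 : relform I 0.
Proof.
exists 0, [::]; split=> //; first by case: idI.
by rewrite raddf0 /osum big_nil addr0.
Qed.

Lemma relformD v w : relform I v -> relform I w -> relform I (v + w).
Proof.
case: (idI) => _ [ID _] [z [s [Iz Is ->]]] [z' [s' [Iz' Is' ->]]].
exists (z + z'), (s ++ s'); split; first exact: ID.
  by move=> p; rewrite mem_cat => /orP[/Is|/Is'].
by rewrite raddfD osum_cat addrACA.
Qed.

Lemma relform_coef a w : I a -> relform I (a *: w).
Proof.
case: (osum_surj w) => s ->; rewrite -osum_scale => Ia.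
exists 0, (dscale a s); split; first by case: idI.
  move=> _ /mapP[q qs ->] /=; rewrite mulrC; case: idI => _ [_]; exact.
by rewrite raddf0 add0r.
Qed.

Lemma relform_dif z : I z -> relform I (dif z).
Proof. by move=> Iz; exists z, [::]; split=> //; rewrite /osum big_nil addr0. Qed.

(** Stability under A comes from a dz = d(az) - z da. *)
Lemma relformZ a w : relform I w -> relform I (a *: w).
Proof.
case: (idI) => _ [_ IM] [z [s [Iz Is ->]]]; rewrite scalerDr; apply: relformD.
  have -> : a *: dif z = dif (a * z) + (- z) *: dif a.
    by rewrite difM scaleNr addrK.
  apply: relformD; first exact/relform_dif/IM.
  exact/relform_coef/is_idealN.
rewrite -osum_scale; elim: s Is => [|p s IH] Is; first by rewrite /osum big_nil; apply: relform0.
rewrite /osum /= big_cons; apply: relformD; last by apply: IH => q qs; apply: Is; rewrite inE qs orbT.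
by apply/relform_coef/IM/Is; rewrite inE eqxx.
Qed.

Lemma relformN w : relform I w -> relform I (- w).
Proof. by move=> ?; rewrite -scaleN1r; apply: relformZ. Qed.

Definition relform_pred : {pred omega A} := fun w => `[< relform I w >].
Lemma relform_zmod : zmod_closed relform_pred.
Proof.
split; first by apply/asboolP/relform0.
by move=> v w /asboolP Hv /asboolP Hw; apply/asboolP/relformD => //; apply: relformN.
Qed.
HB.instance Definition _ := GRing.isZmodClosed.Build (omega A) relform_pred relform_zmod.

Definition relquot := Quotient.quot (relform_pred : zmodClosed (omega A)).
HB.instance Definition _ := GRing.Zmodule.on relquot.

Definition relproj (w : omega A) : relquot := \pi w.
Lemma relprojB v w : relform I (v - w) -> relproj v = relproj w.
Proof.
by move=> H; apply/eqP; rewrite /relproj -Quotient.idealrBE; apply/asboolP.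
Qed.
Lemma relproj_zmod : zmod_morphism relproj.
Proof. by move=> v w; rewrite /relproj raddfB. Qed.
HB.instance Definition _ := GRing.isZmodMorphism.Build (omega A) relquot relproj relproj_zmod.
Lemma relproj_eq0 w : relproj w = 0 -> relform I w.
Proof.
rewrite -(raddf0 relproj) => /eqP; rewrite /relproj -Quotient.idealrBE subr0.
by move/asboolP.
Qed.

Variables (Q : comAlgType k) (pi : {lrmorphism A -> Q}).
Hypotheses (pi_surj : forall q, exists a, pi a = q) (pi_ker : forall a, pi a = 0 <-> I a).

Lemma relform_congr a a' b b' : pi a = pi a' -> pi b = pi b' ->
  relproj (a *: dif b) = relproj (a' *: dif b').
Proof.
move=> ea eb; apply: relprojB.
have -> : a *: dif b - a' *: dif b' = (a - a') *: dif b + a' *: dif (b - b').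
  by rewrite scalerBl raddfB scalerBr addrA subrK.
apply: relformD; first by apply/relform_coef/pi_ker; rewrite rmorphB /= ea subrr.
by apply/relformZ/relform_dif/pi_ker; rewrite rmorphB /= eb subrr.
Qed.

(** A set-theoretic section [sec] defines a map a db |-> class of [sec a] d([sec b]) from Omega_Q to
    Omega_A modulo [relform I], inverse to the projection; [relform_congr] makes it respect the
    defining relations. *)
Lemma kd_null_quotient s : kd_null (dmap pi s) <-> relform I (osum s).
Proof.
split=> [H|[z [t [Iz It e]]]].
  have [sec secP] := choice pi_surj.
  apply: relproj_eq0.
  have -> : relproj (osum s) = \sum_(p <- dmap pi s) relproj (sec p.1 *: dif (sec p.2)).
    rewrite big_map /osum raddf_sum /=.
    apply: eq_bigr => p _; apply: relform_congr; by rewrite (secP (pi _)).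
  refine (kd_sum0 (phi := fun a b => relproj (sec a *: dif (sec b))) _ _ _ _ H).
  - move=> a a' b; rewrite -raddfD -scalerDl; apply: relform_congr => //.
    by rewrite rmorphD /= !secP.
  - move=> a b c; rewrite -raddfD -scalerDr -raddfD; apply: relform_congr => //.
    by rewrite rmorphD /= !secP.
  - move=> a b c.
    rewrite (@relform_congr (sec a) (sec a) (sec (b * c)) (sec b * sec c)) //; last first.
      by rewrite rmorphM /= !secP.
    rewrite difM scalerDr !scalerA raddfD; congr (_ + _); apply: relform_congr => //;
      by rewrite rmorphM /= !secP.
  - move=> a l; rewrite (@relform_congr (sec a) (sec a) _ (l%:A)) //.
      by rewrite dif_const scaler0 raddf0.
    by rewrite secP linearZ /= rmorph1.
apply/osum0; rewrite -opushE e opushD opush_dif; have /pi_ker -> := Iz.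
rewrite raddf0 add0r opushE osum_dmap big_seq big1 // => p pt.
by have /pi_ker -> := It _ pt; rewrite scale0r.
Qed.
End QuotientForms.

(** * Spans modulo a subspace *)

Section SpanModulo.
Variables (k : fieldType) (V : lmodType k).
Implicit Types (U W : V -> Prop) (vs : seq V).

Definition is_submod U :=
  [/\ U 0, forall x y, U x -> U y -> U (x + y) & forall (l : k) x, U x -> U (l *: x)].

(** Membership in [U] plus the span of [vs], one vector at a time: finite dimension of V/U is
    expressed without forming V/U. *)
Fixpoint inspan U vs (a : V) : Prop :=
  if vs is v :: vs' then exists c : k, inspan U vs' (a - c *: v) else U a.

Lemma inspan_submod U vs : is_submod U -> is_submod (inspan U vs).
Proof.
move=> sU; elim: vs => [|v vs [I0 ID IZ]] //=; split.
- by exists 0; rewrite scale0r subr0.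
- move=> x y [c Hc] [d Hd]; exists (c + d).
  by rewrite scalerDl opprD addrACA; apply: ID.
- by move=> l x [c Hc]; exists (l * c); rewrite -scalerA -scalerBr; apply: IZ.
Qed.

Lemma inspan_base U vs a : is_submod U -> U a -> inspan U vs a.
Proof.
by move=> sU Ua; elim: vs => //= v vs IH; exists 0; rewrite scale0r subr0.
Qed.

Lemma inspan_mono U W vs a : (forall x, U x -> W x) -> inspan U vs a -> inspan W vs a.
Proof. by move=> UW; elim: vs a => [|v vs IH] a /=; [apply: UW|case=> c /IH; exists c]. Qed.

Lemma inspan_mem U vs a : is_submod U -> a \in vs -> inspan U vs a.
Proof.
move=> sU; elim: vs => //= v vs IH; rewrite inE => /orP[/eqP ->|/IH H].
  by exists 1; rewrite scale1r subrr; case: (inspan_submod vs sU).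
by exists 0; rewrite scale0r subr0.
Qed.

Lemma inspanP U vs a : inspan U vs a <->
  exists c : 'I_(size vs) -> k, U (a - \sum_(i < size vs) c i *: vs`_i).
Proof.
elim: vs a => [|v vs IH] a /=.
  by split=> [Ua|[c]]; [exists (fun=> 0)|]; rewrite big_ord0 subr0.
split=> [[c /IH [d Hd]]|[c Hc]].
  exists (fun i => if unlift ord0 i is Some j then d j else c).
  rewrite big_ord_recl unlift_none /= opprD addrA.
  rewrite (eq_bigr (fun i => d i *: vs`_i)) // => i _.
  by rewrite liftK.
exists (c ord0); apply/IH; exists (fun i => c (lift ord0 i)).
by move: Hc; rewrite big_ord_recl /= opprD addrA.
Qed.

Lemma inspan_dependent U vs n (a : 'I_n -> V) : is_submod U -> (size vs < n)%N ->
  (forall i, inspan U vs (a i)) ->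
  exists c : 'I_n -> k, (exists i, c i != 0) /\ U (\sum_i c i *: a i).
Proof.
move=> sU ltn Ha.
have [C HC] := choice (fun i => (inspanP U vs (a i)).1 (Ha i)).
pose M := \matrix_(i < n, j < size vs) C i j.
have : kermx M != 0.
  rewrite -mxrank_eq0 mxrank_ker subn_eq0 -ltnNge.
  exact: leq_ltn_trans (rank_leq_col _) ltn.
case/rowV0Pn => u /sub_kermxP uM u0.
exists (fun i => u ord0 i); split.
  apply: contrapT => H; case/eqP: u0; apply/rowP => i; rewrite mxE.
  by apply/eqP; apply: contrapT => /negP ui; apply: H; exists i.
have -> : \sum_i u ord0 i *: a i =
   \sum_i u ord0 i *: (a i - \sum_(j < size vs) C i j *: vs`_j).
  apply/eqP; rewrite -subr_eq0 -sumrB.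
  under eq_bigr do rewrite -scalerBr opprB addrC subrK scaler_sumr.
  rewrite exchange_big /= big1 // => j _.
  under eq_bigr do rewrite scalerA.
  rewrite -scaler_suml; have /rowP/(_ j) := uM; rewrite !mxE.
  under eq_bigr do rewrite mxE.
  by move->; rewrite scale0r.
case: sU => U0 UD UZ; elim/big_ind: _ => // i _; exact/UZ/HC.
Qed.

Lemma inspan_sub U W vs : is_submod U -> is_submod W ->
  (forall a, W a -> inspan U vs a) ->
  exists ws, (forall w, w \in ws -> W w) /\ forall a, W a -> inspan U ws a.
Proof.
move=> sU; elim: vs W => [|v vs IH] W sW H; first by exists [::].
have sS := inspan_submod vs sU.
have sW' : is_submod (fun a => W a /\ inspan U vs a).
  case: sW => W0 WD WZ; case: sS => S0 SD SZ; split=> //.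
  - by move=> x y [? ?] [? ?]; split; [apply: WD|apply: SD].
  - by move=> l x [? ?]; split; [apply: WZ|apply: SZ].
have [ws [Wws Hws]] := IH _ sW' (fun a Ha => Ha.2).
have [[w [c [Ww c0 Hc]]]|N] :=
  pselect (exists w c, [/\ W w, c != 0 & inspan U vs (w - c *: v)]).
  exists (w :: ws); split=> [x|a Wa /=].
    by rewrite inE => /orP[/eqP ->//|/Wws[]].
  have [d Hd] := H _ Wa; exists (d / c); apply: Hws.
  case: sW => W0 WD WZ; case: sS => S0 SD SZ.
  split; first by rewrite -scaleNr; apply: WD => //; apply: WZ.
  have -> : a - (d / c) *: w = (a - d *: v) + (- (d / c)) *: (w - c *: v).
    by rewrite scalerBr scalerA mulNr divfK // !scaleNr opprK addrCA subrK addrC.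
  by apply: SD => //; apply: SZ.
exists ws; split=> [w /Wws[] //|a Wa]; apply: Hws; split=> //.
have [d Hd] := H _ Wa; have [d0|d0] := eqVneq d 0.
  by move: Hd; rewrite d0 scale0r subr0.
by case: N; exists a, d.
Qed.
End SpanModulo.

(** * Algebras of finite dimension modulo an ideal, and Fitting's relation *)

Section FiniteModulo.
Variables (k : fieldType) (S : comAlgType k).
Implicit Type U : S -> Prop.

Lemma is_ideal_submod U : is_ideal U -> is_submod U.
Proof.
move=> [U0 [UD UM]]; split=> // l x Ux.
by rewrite -mulr_algl; apply: UM.
Qed.

Lemma inspan_poly U vs b : is_ideal U -> (forall a, inspan U vs a) ->
  exists2 p : {poly k}, p != 0 & U (horner_alg b p).
Proof.
move=> idU H; have sU := is_ideal_submod idU.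
have [c [[i ci] Uc]] := inspan_dependent (a := fun i : 'I_(size vs).+1 => b ^+ i) sU
  (leqnn _) (fun i => H _).
exists (\poly_(i < (size vs).+1) c (inord i)).
  apply: contraNneq ci => /polyP/(_ i); rewrite coef_poly ltn_ord coef0 inord_val.
  by move->.
rewrite poly_def raddf_sum /=; move: Uc; congr U.
by apply: eq_bigr => j _; rewrite inord_val linearZ rmorphXn /= horner_algX mulr_algl.
Qed.

(** A nonzero polynomial whose value at b lies in U is X^m times one with nonzero constant term;
    dividing by that constant expresses b^m through b^(m+1) modulo U. *)
Lemma inspan_fitting U vs b : is_ideal U -> (forall a, inspan U vs a) ->
  exists m q, U (b ^+ m - b ^+ m.+1 * q).
Proof.
move=> idU H; have [p p0 Up] := inspan_poly b idU H.
have [m [q]] := multiplicity_XsubC p 0; rewrite p0 /= subr0 => q0 pE.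
have [r [c [c0 qE]]] : exists r c, c != 0 /\ q = r * 'X + c%:P.
  elim/poly_ind: q q0 {pE} => [|r c _]; first by rewrite root0.
  by rewrite /root !hornerE => c0; exists r, c.
exists m, (- c^-1 *: horner_alg b r).
move: Up; rewrite pE qE !(rmorphM, rmorphD, rmorphXn) /= !horner_algX.
rewrite horner_algC.
move=> Up; case: idU => _ [_ UM]; have := UM (c^-1 *: 1) _ Up.
congr U; rewrite scaleNr -[c^-1 *: horner_alg b r]mulr_algl exprS.
have e : c^-1%:A * c%:A = 1 :> S by rewrite mulr_algl scalerA mulVf // scale1r.
by ring: e.
Qed.

Lemma finite_algP : finite_alg S <-> exists vs, forall a : S, inspan (eq 0) vs a.
Proof.
split=> [[n [v H]]|[vs H]].
  exists (codom v) => a; have [c ->] := H a.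
  have s0 : is_submod (eq (0 : S)).
    by split=> // [x y <- <-|l x <-]; rewrite ?addr0 ?scaler0.
  have [S0 SD SZ] := inspan_submod (codom v) s0.
  elim/big_ind: _ => // i _; apply/SZ/inspan_mem => //; exact: codom_f.
exists (size vs), (fun i => vs`_i) => a; have [c Hc] := (inspanP _ _ _).1 (H a).
by exists c; apply/eqP; rewrite -subr_eq0 -Hc.
Qed.

Lemma eq0_ideal : is_ideal (eq (0 : S)).
Proof.
by split=> //; split=> [x y <- <-|r x <-]; rewrite ?addr0 ?mulr0.
Qed.
End FiniteModulo.

(** * Finite algebras with principal nilradical *)

Section FinitePIA.
Variables (k : fieldType) (B : comAlgType k).
Hypothesis finB : finite_alg B.

(** From b^(m+1) = b^(m+2) q, the element (bq)^(m+1) is an idempotent on which b is invertible,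
    while b is nilpotent on the complement. *)
Lemma fitting_idem (b : B) :
  exists e w, [/\ e * e = e, e = b * w & nilpotent_el ((1 - e) * b)].
Proof.
have [vs Hvs] := (finite_algP B).1 finB.
have [m [q Hq]] := inspan_fitting b (eq0_ideal B) Hvs.
have {}Hq : b ^+ m.+1 = b ^+ m.+2 * q.
  apply/eqP; rewrite -subr_eq0.
  have -> : b ^+ m.+1 - b ^+ m.+2 * q = b * (b ^+ m - b ^+ m.+1 * q).
    by rewrite mulrBr mulrA -!exprS.
  by rewrite -Hq mulr0.
have Hj j : b ^+ m.+1 * (b * q) ^+ j = b ^+ m.+1.
  elim: j => [|j IH]; first by rewrite mulr1.
  by rewrite [(b * q) ^+ _]exprSr mulrA IH [in RHS]Hq (exprS b m.+1) mulrCA mulrA.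
pose e := (b * q) ^+ m.+1.
have be : b ^+ m.+1 * e = b ^+ m.+1 by exact: Hj.
have eE : e = b ^+ m.+1 * q ^+ m.+1 by rewrite -exprMn.
exists e, (b ^+ m * q ^+ m.+1); split.
- by rewrite {1}eE mulrAC be -eE.
- by rewrite eE exprS mulrA.
by exists m.+1; rewrite exprMn exprS mulrAC mulrBl mul1r mulrC [e * _]mulrC be subrr mulr0.
Qed.

Variable t : B.
Hypotheses (nilt : nilpotent_el t)
  (tgen : forall y : B, nilpotent_el y -> exists z, y = z * t).

Lemma nilpotentM (x y : B) : nilpotent_el x -> nilpotent_el (y * x).
Proof. by case=> n xn; exists n; rewrite exprMn xn mulr0. Qed.

Lemma bezout2 (a b : B) : exists g x y u v,
  [/\ g = x * a + y * b, a = u * g & b = v * g].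
Proof.
have [N tN] := nilt.
(* The statement is multiplied by t^i and proved by induction on N - i: it is trivial at i = N, and
   dividing by t on [f] replaces i by i + 1. *)
suff H n i : (i + n)%N = N -> forall a b, exists g x y u v,
    let T := t ^+ i in
    [/\ T * g = T * (x * a + y * b), T * a = T * (u * g) & T * b = T * (v * g)].
  have [g [x [y [u [v]]]]] := H N 0%N (add0n N) a b.
  by rewrite /= expr0 !mul1r => -[? ? ?]; exists g, x, y, u, v.
elim: n i => [|n IH] i; rewrite ?addn0 => iN {}a {}b.
  by exists 0, 0, 0, 0, 0 => /=; rewrite iN tN !mul0r.
have [ea [wa [ea2 eaE na]]] := fitting_idem a.
have [eb [wb [eb2 ebE nb]]] := fitting_idem b.
pose f := (1 - ea) * (1 - eb).
have f2 : f * f = f.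
  by rewrite /f; ring: ea2 eb2.
have eaf : ea * f = 0 by rewrite /f; ring: ea2.
have ebf : eb * f = 0 by rewrite /f; ring: eb2.
have [a' fa] : exists z, f * a = z * t.
  by apply: tgen; rewrite /f mulrAC mulrC; apply: nilpotentM.
have [b' fb] : exists z, f * b = z * t.
  by apply: tgen; rewrite /f -mulrA; apply: nilpotentM.
have [|g' [x' [y' [u' [v' [Hg Ha Hb]]]]]] := IH i.+1 _ a' b'.
  by rewrite addSn -addnS.
pose h := (1 - ea) * eb.
have hE : 1 = ea + h + f by rewrite /h /f; ring.
have h2 : h * h = h by rewrite /h; ring: ea2 eb2.
have eah : ea * h = 0 by rewrite /h; ring: ea2.
have hf : h * f = 0 by rewrite /h /f; ring: ea2 eb2.
have heb : h * eb = h by rewrite /h; ring: eb2.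
clearbody f h.
pose g := ea * a + h * b + f * t * g'.
have eag : ea * g = ea * a by rewrite /g !mulrDr !mulrA ea2 eah eaf !mul0r !addr0.
have hg : h * g = h * b by rewrite /g !mulrDr !mulrA h2 [h * ea]mulrC eah hf !mul0r addr0 add0r.
have fg : f * g = f * t * g' by rewrite /g !mulrDr !mulrA f2 [f * ea]mulrC [f * h]mulrC eaf hf !mul0r !add0r.
set T := t ^+ i in Hg Ha Hb *; rewrite !exprSr -/T in Hg Ha Hb.
exists g, (ea + f * x'), (h + f * y'), (ea + h * wb * a + f * u'), (ea * wa * b + h + f * v').
split.
- have -> : T * g = T * (ea * a + h * b) + f * (T * t * g') by rewrite /g; ring.
  rewrite Hg.
  have -> : f * (T * t * (x' * a' + y' * b')) = T * f * (x' * (a' * t) + y' * (b' * t)) by ring.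
  by rewrite -fa -fb; ring: f2.
- have -> : T * ((ea + h * wb * a + f * u') * g) =
    T * (ea * g) + T * wb * a * (h * g) + T * u' * (f * g) by ring.
  rewrite eag hg fg.
  have -> : T * u' * (f * t * g') = f * (T * t * (u' * g')) by ring.
  rewrite -Ha.
  have -> : f * (T * t * a') = T * f * (a' * t) by ring.
  rewrite -fa.
  have -> : T * wb * a * (h * b) = T * a * (h * (b * wb)) by ring.
  rewrite -ebE heb -{1}[a]mul1r {1}hE; ring: f2.
have -> : T * ((ea * wa * b + h + f * v') * g) =
    T * wa * b * (ea * g) + T * (h * g) + T * v' * (f * g) by ring.
rewrite eag hg fg.
have -> : T * v' * (f * t * g') = f * (T * t * (v' * g')) by ring.
rewrite -Hb.
have -> : f * (T * t * b') = T * f * (b' * t) by ring.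
rewrite -fb.
have -> : T * wa * b * (ea * a) = T * b * (ea * (a * wa)) by ring.
by rewrite -eaE ea2 -{1}[b]mul1r {1}hE; ring: f2.
Qed.

Lemma PIA_nil : PIA B.
Proof.
split=> // I idI; have [vs Hvs] := (finite_algP B).1 finB.
have sU := is_ideal_submod (eq0_ideal B).
have [ws [Iws Hws]] := inspan_sub sU (is_ideal_submod idI) (fun a _ => Hvs a).
have [g [Ig Hg]] : exists g, I g /\ forall w, w \in ws -> exists y, w = y * g.
  elim: ws Iws {Hws} => [|w ws IH] Iws; first by exists 0; split=> //; case: idI.
  have [|g [Ig Hg]] := IH; first by move=> x xs; apply: Iws; rewrite inE xs orbT.
  have [g' [x [y [u [v [g'E wE gE]]]]]] := bezout2 w g.
  exists g'; split.
    case: idI => _ [ID IM]; rewrite g'E; apply: ID; apply: IM => //.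
    by apply: Iws; rewrite inE eqxx.
  move=> z; rewrite inE => /orP[/eqP ->|/Hg[c ->]]; first by exists u.
  by exists (c * v); rewrite -mulrA -gE.
exists g => x; split=> [Ix|[y ->]]; last by case: idI => _ [_]; apply.
have : inspan (eq 0) ws x by exact: Hws.
elim: ws Hg x {Ix Hws Iws} => [|w ws IH] Hg x /=.
  by move=> <-; exists 0; rewrite mul0r.
case=> c /IH[|y E]; first by move=> z zs; apply: Hg; rewrite inE zs orbT.
have [|z wE] := Hg w; first by rewrite inE eqxx.
exists (y + c *: z); rewrite mulrDl -E -scalerAl -wE subrK //.
Qed.
End FinitePIA.

(** * Jordan-Chevalley decomposition and integration of forms *)

Section JordanChevalley.
Variables (k : fieldType) (B : comAlgType k).
Hypotheses (char0 : [pchar k] =i pred0) (finB : finite_alg B).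
Implicit Types P Q : {poly k}.

Lemma natk_neq0 n : (n.+1%:R : k) != 0.
Proof. by rewrite (pcharf0P _).1. Qed.

Lemma horner_alg_split (b : B) Q c :
  horner_alg b (Q * 'X + c%:P) = horner_alg b Q * b + c%:A.
Proof. by rewrite rmorphD rmorphM /= horner_algX horner_algC. Qed.

Lemma horner_alg_taylor P (x h : B) : exists w,
  horner_alg (x + h) P = horner_alg x P + horner_alg x P^`() * h + h ^+ 2 * w.
Proof.
elim/poly_ind: P => [|Q c [w IH]].
  by exists 0; rewrite deriv0 !rmorph0; ring.
exists (w * (x + h) + horner_alg x Q^`()).
rewrite !derivE ?addr0 ?mulr1 !horner_alg_split IH rmorphD rmorphM /= horner_algX.
by ring.
Qed.

Lemma dif_horner_alg P (x : B) : dif (horner_alg x P) = horner_alg x P^`() *: dif x.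
Proof.
elim/poly_ind: P => [|Q c IH].
  by rewrite deriv0 !rmorph0 raddf0 scale0r.
rewrite horner_alg_split raddfD /= dif_const addr0 difM IH scalerA -scalerDl.
by rewrite !derivE ?addr0 ?mulr1 rmorphD rmorphM /= horner_algX; congr (_ *: _); ring.
Qed.

(** A polynomial of least size among those nilpotent at b has no square factor: if P = w u^2, then
    (w u)^2 = w P is nilpotent at b. In characteristic 0 this makes it separable. *)
Lemma nilpotent_horner_sep (b : B) :
  exists2 P, separable_poly P & nilpotent_el (horner_alg b P).
Proof.
have [vs Hvs] := (finite_algP B).1 finB.
pose nil_size m := `[< exists P, [/\ P != 0, size P = m & nilpotent_el (horner_alg b P)] >].
have ex : exists m, nil_size m.
  have [p p0 pb] := inspan_poly b (eq0_ideal B) Hvs.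
  by exists (size p); apply/asboolP; exists p; split=> //; exists 1; rewrite expr1.
case: (ex_minnP ex) => _ /asboolP[P [P0 <- [n nP]]] min.
exists P; last by exists n.
apply/separable_polyP; split=> [|u uP su].
  apply/poly_square_freeP => u su; apply/negP => /dvdpP[w PE].
  have u0 : u != 0 by apply: contraNneq P0 => u0; rewrite PE u0 expr0n mulr0.
  have w0 : w != 0 by apply: contraNneq P0 => w0; rewrite PE w0 mul0r.
  have : nil_size (size (w * u)).
    apply/asboolP; exists (w * u); split=> //; first by rewrite mulf_neq0.
    exists (2 * n)%N; rewrite exprM -rmorphXn exprMn expr2 -mulrA -PE.
    by rewrite rmorphM exprMn nP mulr0.
  move/min; rewrite leqNgt PE expr2 mulrA [size (w * u * u)]size_mul ?mulf_neq0 //.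
  have su1 : (1 < size u)%N.
    by move: su u0; rewrite -size_poly_gt0; case: (size u) => [|[]].
  have sw : (0 < size (w * u)%R)%N by rewrite size_poly_gt0 mulf_neq0.
  by case: (size u) su1 => [|[|m]] // _; rewrite !addnS /= ltnS leq_addr.
apply/eqP => /polyP/(_ (size u).-2); rewrite coef_deriv coef0.
case E: (size u) su => [|[|m]] //= _ => /eqP.
rewrite -mulr_natr mulf_eq0 (negbTE (natk_neq0 _)) orbF => /eqP H.
have /eqP : lead_coef u = 0 by rewrite /lead_coef E.
by rewrite lead_coef_eq0 -size_poly_eq0 E.
Qed.

(** Newton's iteration from b, with the Bezout coefficient V(s) as approximate inverse of P'(s),
    reaches an exact root s of P. Then 0 = dP(s) = P'(s) ds with P'(s) invertible, so ds = 0. *)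
Lemma jordan_chevalley (b : B) :
  exists s n, [/\ b = s + n, dif s = 0 & nilpotent_el n].
Proof.
have [P cP nP] := nilpotent_horner_sep b; rewrite unlock in cP; set N := horner_alg b P in nP.
have /Bezout_eq1_coprimepP[[U V] /= UV] := cP.
have newton i : exists s y z, s = b + y * N /\ horner_alg s P = z * N ^+ i.+1.
  elim: i => [|i [s [y [z [sE sP]]]]].
    by exists b, 0, 1; rewrite mul0r addr0 mul1r expr1.
  have [w Hw] := horner_alg_taylor P s (- (horner_alg s P * horner_alg s V)).
  exists (s - horner_alg s P * horner_alg s V).
  exists (y - z * N ^+ i * horner_alg s V).
  exists (z ^+ 2 * N ^+ i * (horner_alg s U + horner_alg s V ^+ 2 * w)); split.
    by rewrite sP sE exprSr; ring.
  rewrite Hw; have : horner_alg s (U * P + V * P^`()) = 1 by rewrite UV rmorph1.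
  rewrite rmorphD !rmorphM /=; set p := horner_alg s P in sP *.
  set p' := horner_alg s P^`(); set v := horner_alg s V; set u := horner_alg s U => e.
  have -> : p + p' * - (p * v) + (- (p * v)) ^+ 2 * w =
    p * ((u * p + v * p') - v * p') + p ^+ 2 * v ^+ 2 * w by rewrite e; ring.
  by rewrite sP !exprS; ring.
have [n Nn] := nP; have [s [y [z [sE sP]]]] := newton n.
exists s, (- (y * N)); split; first by rewrite sE addrK.
  have /(congr1 (@dif k B)) := sP.
  rewrite exprS Nn !mulr0 raddf0 dif_horner_alg => /(congr1 (fun w => horner_alg s V *: w)).
  rewrite scaler0 scalerA -rmorphM.
  have -> : V * P^`() = 1 - U * P by rewrite -UV addrC addKr.
  by rewrite rmorphB rmorphM /= sP exprS Nn !mulr0 subr0 rmorph1 scale1r.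
by rewrite -mulNr; apply: nilpotentM.
Qed.

Variable t : B.
Hypotheses (nilt : nilpotent_el t)
  (tgen : forall y : B, nilpotent_el y -> exists z, y = z * t).

(** Elements with zero differential stand in for a coefficient field: each remainder is split by
    [jordan_chevalley], and its nilpotent part is divided by t. *)
Lemma uniformizer_expansion (b : B) : exists D (s : nat -> B),
  (forall j, dif (s j) = 0) /\ b = \sum_(j < D) s j * t ^+ j.
Proof.
suff H D : exists (s : nat -> B) r, (forall j, dif (s j) = 0) /\
    b = \sum_(j < D) s j * t ^+ j + r * t ^+ D.
  have [D tD] := nilt; have [s [r [ds bE]]] := H D.
  by exists D, s; split=> //; rewrite {1}bE tD mulr0 addr0.
elim: D => [|D [s [r [ds bE]]]].
  by exists (fun=> 0), b; split=> [j|]; rewrite ?raddf0 // big_ord0 add0r mulr1.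
have [r0 [n [rE dr0 nn]]] := jordan_chevalley r.
have [z nE] := tgen nn.
exists (fun j => if j == D then r0 else s j), z; split=> [j|]; first by case: ifP.
rewrite big_ord_recr /= eqxx {1}bE rE nE exprS mulrDl addrA -mulrA.
congr (_ + _ + _); apply: eq_bigr => j _.
by rewrite ltn_eqF.
Qed.

Lemma dif_uniformizer (b : B) : exists g, dif b = g *: dif t.
Proof.
have [D [s [ds ->]]] := uniformizer_expansion b.
exists (\sum_(j < D) s j * (j%:R * t ^+ j.-1)).
rewrite raddf_sum scaler_suml; apply: eq_bigr => j _ /=.
by rewrite difM ds scaler0 addr0 difX scalerA.
Qed.

(* Formal integration, available in characteristic 0: if y = sum_j s_j t^j with
   d s_j = 0, then t^N y dt is the differential of sum_j s_j t^(N+j+1) / (N+j+1). *)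
Lemma form_integration N (y b : B) : exists v, (t ^+ N * y) *: dif b = dif (t ^+ N * v).
Proof.
have [g ->] := dif_uniformizer b; rewrite scalerA -mulrA.
have [D [s [ds ->]]] := uniformizer_expansion (y * g).
exists (\sum_(j < D) (N + j).+1%:R^-1 *: (s j * t ^+ j.+1)).
rewrite !mulr_sumr raddf_sum scaler_suml; apply: eq_bigr => j _ /=.
rewrite -scalerAr mulrCA -exprD mulrCA -exprD addnS difZ difM ds scaler0 addr0.
rewrite difX /= !scalerA; congr (_ *: _).
rewrite [s j * (_ * _)]mulrCA !mulrA.
suff -> : (N + j).+1%:R^-1%:A * (N + j).+1%:R = 1 :> B by rewrite mul1r.
by rewrite mulr_algl -scaler_nat scalerA mulVf ?natk_neq0 // scale1r.
Qed.
End JordanChevalley.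

(** * Prime ideals and Krull dimension one *)

Section Primes.
Variables (k : fieldType) (R : comAlgType k).
Implicit Types (I J P Q : R -> Prop).

(** An ideal Q maximal among those containing I and disjoint from W is prime: if x and y are not in
    Q, then Q + (x) and Q + (y) both meet W, and the product of the two elements found lies in Q +
    (xy). *)
Lemma prime_avoiding I (W : R -> Prop) :
  is_ideal I -> W 1 -> (forall x y, W x -> W y -> W (x * y)) ->
  (forall x, W x -> ~ I x) ->
  exists Q, [/\ prime_ideal Q, forall x, I x -> Q x & forall x, W x -> ~ Q x].
Proof.
move=> idI W1 WM WI.
pose T := {J : R -> Prop | [/\ is_ideal J, forall x, I x -> J x & forall x, W x -> ~ J x]}.
have t0 : T by exists I; split.
pose r (s t : T) := `[< forall x, sval s x -> sval t x >].
have r_refl s : r s s by apply/asboolP.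
have r_trans s t u : r s t -> r t u -> r s u.
  by move=> /asboolP st /asboolP tu; apply/asboolP => x /st/tu.
have [A totA|[Q [idQ IQ WQ]] maxQ] := ZL_preorder t0 r_refl r_trans.
  (* Including [I] in the union covers the empty chain. *)
  have idU : is_ideal (fun x => I x \/ exists2 s, A s & sval s x).
    case: (idI) => I0 [ID IM]; split; first by left.
    have up (s : T) x : I x \/ sval s x -> sval s x.
      by case=> // Ix; have [_ IJ _] := svalP s; apply: IJ.
    have add (s : T) x y : sval s x -> sval s y -> sval s (x + y).
      by have [[_ [JD _]] _ _] := svalP s; apply: JD.
    split=> [x y [Ix|[s As sx]] [Iy|[t At ty]]|a x [Ix|[s As sx]]].
    - by left; apply: ID.
    - by right; exists t => //; apply: add => //; apply: up; left.
    - by right; exists s => //; apply: add => //; apply: up; left.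
    - by right; have [/asboolP st|/asboolP ts] := totA _ _ As At;
        [exists t|exists s] => //; apply: add => //; [apply: st|apply: ts].
    - by left; apply: IM.
    - by right; exists s => //; have [[_ [_ JM]] _ _] := svalP s; apply: JM.
  have pU : [/\ is_ideal (fun x => I x \/ exists2 s, A s & sval s x),
     forall x, I x -> I x \/ exists2 s, A s & sval s x &
     forall x, W x -> ~ (I x \/ exists2 s, A s & sval s x)].
    split=> // [x Ix|x Wx [/(WI x Wx)//|[s _ sx]]]; [by left|].
    by have [_ _ /(_ x Wx)] := svalP s.
  by exists (exist _ _ pU : T) => s As; apply/asboolP => x sx /=; right; exists s.
exists Q; split=> //; split=> //; split=> [/(WQ _ W1)//|x y Qxy].
apply: contrapT => /not_orP[nQx nQy].
have ext z : ~ Q z -> exists2 w, W w & exists q a, Q q /\ w = q + a * z.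
  move=> nQz; apply: contrapT => N.
  have pJ : [/\ is_ideal (fun w => exists q a, Q q /\ w = q + a * z),
      forall w, I w -> exists q a, Q q /\ w = q + a * z
    & forall w, W w -> ~ exists q a, Q q /\ w = q + a * z].
    case: (idQ) => Q0 [QD QM]; split=> [|w /IQ Qw|w Ww H].
    - split; first by exists 0, 0; split=> //; rewrite mul0r addr0.
      split=> [u v [q [a [Qq ->]]] [q' [a' [Qq' ->]]]|c u [q [a [Qq ->]]]].
        by exists (q + q'), (a + a'); split; [exact: QD|ring].
      by exists (c * q), (c * a); split; [exact: QM|ring].
    - by exists w, 0; split=> //; rewrite mul0r addr0.
    - by apply: N; exists w.
  have /asboolP H : r (exist _ _ pJ : T) (exist _ Q (And3 idQ IQ WQ) : T).
    by apply: maxQ; apply/asboolP => w /= Qw; exists w, 0; rewrite mul0r addr0.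
  apply/nQz/H; exists 0, 1; split; [by case: (idQ)|by rewrite mul1r add0r].
have [w Ww [q [a [Qq wE]]]] := ext _ nQx; have [w' Ww' [q' [a' [Qq' w'E]]]] := ext _ nQy.
apply: (WQ (w * w')); first exact: WM.
case: (idQ) => _ [QD QM].
have -> : w * w' = (q' + a' * y) * q + (a * x) * q' + (a * a') * (x * y).
  by rewrite wE w'E; ring.
by apply: (QD); [apply: (QD)|]; apply: (QM).
Qed.

Lemma minimal_prime_below Q : prime_ideal Q ->
  exists2 P, minimal_prime P & forall x, P x -> Q x.
Proof.
move=> pQ.
pose T := {P : R -> Prop | prime_ideal P /\ forall x, P x -> Q x}.
have t0 : T by exists Q; split.
pose r (s t : T) := `[< forall x, sval t x -> sval s x >].
have r_refl s : r s s by apply/asboolP.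
have r_trans s t u : r s t -> r t u -> r s u.
  by move=> /asboolP st /asboolP tu; apply/asboolP => x /tu/st.
have [A totA|[P [pP PQ]] maxP] := ZL_preorder t0 r_refl r_trans.
  (* Adding [Q] to the chain keeps the intersection proper and inside [Q] when the chain is
     empty. *)
  pose B s := A s \/ s = (exist _ Q (conj pQ (fun _ => id)) : T).
  have totB s t : B s -> B t -> r s t \/ r t s.
    case=> [As|->] [At|->]; first exact: totA.
    - by right; apply/asboolP; have [_ PQ] := svalP s; apply: PQ.
    - by left; apply/asboolP; have [_ PQ] := svalP t; apply: PQ.
    - by left.
  pose N x := forall s, B s -> sval s x.
  have pN : prime_ideal N.
    split; [split; [|split]|split].
    - by move=> s _; have [[[]]] := svalP s.
    - move=> x y Nx Ny s Bs; have [[[_ [JD _]] _] _] := svalP s.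
      by apply: JD; [apply: Nx|apply: Ny].
    - move=> a x Nx s Bs; have [[[_ [_ JM]] _] _] := svalP s.
      by apply: JM; apply: Nx.
    - move/(_ (exist _ Q (conj pQ (fun _ => id)))) => /= H.
      by case: (pQ) => _ [nQ _]; apply/nQ/H; right.
    move=> x y Nxy; apply: contrapT => /not_orP[/existsNP[s /not_implyP[Bs nsx]]].
    move=> /existsNP[t /not_implyP[Bt nty]].
    have prm (u : T) : B u -> sval u x \/ sval u y.
      by move=> /Nxy; have [[_ [_ JP]] _] := svalP u; apply: JP.
    have [/asboolP st|/asboolP ts] := totB _ _ Bs Bt.
      by have [/st|] := prm _ Bt.
    by have [|/ts] := prm _ Bs.
  have pN' : prime_ideal N /\ forall x, N x -> Q x.
    by split=> // x /(_ (exist _ Q (conj pQ (fun _ => id)))) /=; apply; right.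
  by exists (exist _ N pN' : T) => s As; apply/asboolP => x /= Nx; apply: Nx; left.
exists P => //; split=> // -[P' [pP' [P'P [x [Px nP'x]]]]].
have pT : prime_ideal P' /\ forall x, P' x -> Q x by split=> // z /P'P/PQ.
have /asboolP H : r (exist _ P' pT : T) (exist _ P (conj pP PQ) : T).
  by apply: maxP; apply/asboolP.
by apply: nP'x; apply: H.
Qed.

Lemma reduced_minimal_prime (y : R) : reduced R -> y != 0 -> exists2 P, minimal_prime P & ~ P y.
Proof.
move=> redR y0.
have [|||x [n ->] yn0|Q [pQ _ WQ]] :=
  @prime_avoiding (eq 0) (fun x => exists n, x = y ^+ n).
- exact: eq0_ideal.
- by exists 0%N.
- by move=> _ _ [n ->] [m ->]; exists (n + m)%N; rewrite exprD.
- by case/eqP: y0; apply: redR (esym yn0).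
have [P mP PQ] := minimal_prime_below pQ.
by exists P => // /PQ; apply: WQ; exists 1%N.
Qed.

Hypothesis dimR : pure_dim_one R.

Lemma no_prime_chain Q0 Q1 Q2 : prime_ideal Q0 -> prime_ideal Q1 -> prime_ideal Q2 ->
  strict_sub Q0 Q1 -> strict_sub Q1 Q2 -> False.
Proof.
move=> p0 p1 p2 s01 s12; have [P mP PQ] := minimal_prime_below p0.
case: (dimR mP) => _; apply; exists Q1, Q2; split=> //; split=> //; split=> //.
case: s01 => Q01 [x [Q1x nQ0x]]; split=> [z /PQ/Q01//|].
by exists x; split=> // /PQ.
Qed.

Lemma is_ideal_adjoin Q (a : R) : is_ideal Q -> is_ideal (fun w => exists q r, Q q /\ w = q + r * a).
Proof.
case=> Q0 [QD QM]; split; first by exists 0, 0; split=> //; rewrite mul0r addr0.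
split=> [u v [q [b [Qq ->]]] [q' [b' [Qq' ->]]]|c u [q [b [Qq ->]]]].
  by exists (q + q'), (b + b'); split; [exact: QD|ring].
by exists (c * q), (c * b); split; [exact: QM|ring].
Qed.

(* The Coquand-Lombardi characterisation of Krull dimension at most one. *)
Lemma dim_le1_identity (a b : R) : exists m u v,
  a ^+ m * (b ^+ m * (1 + b * v) + a * u) = 0.
Proof.
apply: contrapT => N.
(* If 0 is not in [W0], there are primes Q0 avoiding [W0], Q1 containing Q0 and a but avoiding [W1],
   and Q2 containing Q1 and b. Then a separates Q0 from Q1 and b separates Q1 from Q2, which is a
   chain of length two. *)
pose W0 x := exists m u v, x = a ^+ m * (b ^+ m * (1 + b * v) + a * u).
pose W1 x := exists m v, x = b ^+ m * (1 + b * v).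
have [|||x [m [u [v ->]]] e|Q0 [p0 _ WQ0]] := @prime_avoiding (eq 0) W0.
- exact: eq0_ideal.
- by exists 0%N, 0, 0; ring.
- move=> _ _ [m [u [v ->]]] [m' [u' [v' ->]]].
  exists (m + m')%N, (b ^+ m * (1 + b * v) * u' + b ^+ m' * (1 + b * v') * u + a * u * u').
  by exists (v + v' + b * v * v'); rewrite !exprD; ring.
- by apply: N; exists m, u, v.
have [idQ0 [_ Q0P]] := p0.
have [|||x [m [v ->]] [q [r [Qq e]]]|Q1 [p1 IQ1 WQ1]] :=
   @prime_avoiding (fun w => exists q r, Q0 q /\ w = q + r * a) W1.
- exact: is_ideal_adjoin.
- by exists 0%N, 0; ring.
- move=> _ _ [m [v ->]] [m' [v' ->]].
  by exists (m + m')%N, (v + v' + b * v * v'); rewrite !exprD; ring.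
- apply: (WQ0 (a ^+ m * (b ^+ m * (1 + b * v) + a * - r))).
    by exists m, (- r), v.
  have -> : b ^+ m * (1 + b * v) + a * - r = q by rewrite e; ring.
  by case: idQ0 => _ [_]; apply.
have [idQ1 [_ Q1P]] := p1.
have [|||_ <- [q [r [Qq e]]]|Q2 [p2 IQ2 WQ2]] :=
   @prime_avoiding (fun w => exists q r, Q1 q /\ w = q + r * b) (eq 1).
- exact: is_ideal_adjoin.
- by [].
- by move=> _ _ <- <-; rewrite mulr1.
- apply: (WQ1 q) => //; exists 0%N, (- r).
  by rewrite expr0 mul1r mulrN [b * r]mulrC; rewrite -[LHS](addrK (r * b)) -e.
apply: (no_prime_chain p0 p1 p2); split.
- by move=> x Qx; apply: IQ1; exists x, 0; rewrite mul0r addr0.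
- exists a; split; first by apply: IQ1; exists 0, 1; split; [case: idQ0|ring].
  move=> Q0a; apply: (WQ0 (a * b)); first by exists 1%N, 0, 0; ring.
  by rewrite mulrC; case: idQ0 => _ [_]; apply.
- by move=> x Qx; apply: IQ2; exists x, 0; rewrite mul0r addr0.
exists b; split; first by apply: IQ2; exists 0, 1; split; [case: idQ1|ring].
by apply: WQ1; exists 1%N, 0; ring.
Qed.
End Primes.

(** * Finite modules over integral extensions *)

Section ModuleSpan.
Variables (P R : comNzRingType) (phi : {rmorphism P -> R}).
Implicit Types (rs : seq R).

Fixpoint modspan rs (a : R) : Prop :=
  if rs is r :: rs' then exists c, modspan rs' (a - phi c * r) else a = 0.

Lemma modspan_ind rs (N : R -> Prop) (f : R -> R) :
  N 0 -> (forall x y, N x -> N y -> N (x + y)) -> (forall c x, N x -> N (phi c * x)) ->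
  (forall x y, f (x + y) = f x + f y) -> (forall c x, f (phi c * x) = phi c * f x) ->
  (forall r, r \in rs -> N (f r)) ->
  forall b, modspan rs b -> N (f b).
Proof.
move=> N0 ND NZ fD fZ; elim: rs => [|r rs IH] H b /=.
  by move=> ->; have -> : f 0 = 0 by apply: (addrI (f 0)); rewrite -fD !addr0.
case=> c Hb; rewrite -(subrK (phi c * r) b) fD fZ; apply: ND.
  by apply: IH => // s ss; apply: H; rewrite inE ss orbT.
by apply/NZ/H; rewrite inE eqxx.
Qed.

Lemma modspan0 rs : modspan rs 0.
Proof. by elim: rs => //= r rs IH; exists 0; rewrite rmorph0 mul0r subr0. Qed.

Lemma modspanD rs x y : modspan rs x -> modspan rs y -> modspan rs (x + y).
Proof.
elim: rs x y => [|r rs IH] x y /=; first by move=> -> ->; rewrite addr0.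
move=> [c Hc] [d Hd]; exists (c + d).
by rewrite rmorphD mulrDl opprD addrACA; apply: IH.
Qed.

Lemma modspanZ rs c x : modspan rs x -> modspan rs (phi c * x).
Proof.
elim: rs x => [|r rs IH] x /=; first by move=> ->; rewrite mulr0.
by move=> [d Hd]; exists (c * d); rewrite rmorphM -mulrA -mulrBr; apply: IH.
Qed.

Lemma modspan_mem rs r : r \in rs -> modspan rs r.
Proof.
elim: rs => //= s rs IH; rewrite inE => /orP[/eqP ->|/IH H].
  by exists 1; rewrite rmorph1 mul1r subrr; apply: modspan0.
by exists 0; rewrite rmorph0 mul0r subr0.
Qed.

Lemma modspanP rs a : modspan rs a ->
  exists c : 'I_(size rs) -> P, a = \sum_(i < size rs) phi (c i) * rs`_i.
Proof.
elim: rs a => [|r rs IH] a /=; first by move=> ->; exists (fun=> 0); rewrite big_ord0.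
move=> [c /IH[d Hd]]; exists (fun i => if unlift ord0 i is Some j then d j else c).
rewrite big_ord_recl unlift_none /= -[LHS](subrK (phi c * r)) addrC Hd.
by congr (_ + _); apply: eq_bigr => i _; rewrite liftK.
Qed.

(** For each new g the generators are multiplied by the powers of g below the degree of its monic
    equation, which reduces all higher powers. *)
Lemma integral_modspan (gs : seq R) : (forall g, integralOver phi g) ->
  exists rs, modspan rs 1 /\ forall g, g \in gs -> forall a, modspan rs a -> modspan rs (g * a).
Proof.
move=> int; elim: gs => [|g gs [rs [rs1 Hrs]]].
  by exists [:: 1]; split=> //; apply: modspan_mem; rewrite inE eqxx.
have [p p_mon pg] := int g; pose e := (size p).-1.
pose rs' := [seq g ^+ j * r | j <- iota 0 e, r <- rs].
have step j b : modspan rs b -> modspan rs' (g ^+ j * b).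
  elim/ltn_ind: j b => j IH b Hb; have [je|ej] := ltnP j e.
    move: b Hb; apply: (@modspan_ind rs (modspan rs') (fun b => g ^+ j * b)).
    - exact: modspan0.
    - exact: modspanD.
    - exact: modspanZ.
    - by move=> x y; rewrite mulrDr.
    - by move=> c x; rewrite mulrCA.
    move=> r rr; apply: modspan_mem; apply/allpairsP; exists (j, r); split=> //=.
    by rewrite mem_iota.
  have ge : g ^+ e = \sum_(i < e) - (phi p`_i * g ^+ i).
    move: pg; rewrite /root horner_coef size_map_poly_id0; last first.
      by rewrite (monicP p_mon) rmorph1 oner_neq0.
    have -> : size p = e.+1 by rewrite prednK // size_poly_gt0 monic_neq0.
    rewrite big_ord_recr /= !coef_map /= -[p`_e]/(lead_coef p) (monicP p_mon).
    rewrite rmorph1 mul1r addrC addr_eq0 => /eqP ->; rewrite sumrN; congr (- _).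
    by apply: eq_bigr => i _; rewrite coef_map.
  rewrite -(subnK ej) exprD ge mulr_sumr mulr_suml.
  elim/big_ind: _ => [|x y|i _]; [exact: modspan0|exact: modspanD|].
  have -> : g ^+ (j - e) * - (phi p`_i * g ^+ i) * b
    = phi (- p`_i) * (g ^+ (j - e + i) * b) by rewrite rmorphN exprD; ring.
  apply/modspanZ/IH => //; rewrite -{2}(subnK ej) ltn_add2l //.
exists rs'; split; first by have := step 0%N 1 rs1; rewrite mulr1.
move=> h hh a; apply: (@modspan_ind rs' (modspan rs') (fun b => h * b)) a.
- exact: modspan0.
- exact: modspanD.
- exact: modspanZ.
- by move=> x y; rewrite mulrDr.
- by move=> c x; rewrite mulrCA.
move=> _ /allpairsP[[j r] [/= _ rr ->]].
move: hh; rewrite inE => /orP[/eqP ->|hg].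
  by rewrite mulrA -exprS; apply/step/modspan_mem.
by rewrite mulrCA; apply/step/Hrs => //; apply: modspan_mem.
Qed.

(** By the adjugate, det Z kills every r_j, hence the span of [rs], hence 1. *)
Lemma det_trick rs n (Z : 'M[P]_n) (r : 'I_n -> R) :
  modspan rs 1 -> (forall x, x \in rs -> exists i, x = r i) ->
  (forall i, \sum_j phi (Z i j) * r j = 0) -> phi (\det Z) = 0.
Proof.
move=> rs1 rsr HZ.
have Zr : map_mx phi Z *m (\col_j r j) = 0.
  apply/colP => i; rewrite !mxE -[RHS](HZ i).
  by apply: eq_bigr => j _; rewrite !mxE.
have ann i : phi (\det Z) * r i = 0.
  have /colP/(_ i) : (phi (\det Z))%:M *m (\col_j r j) = 0.
    by rewrite -det_map_mx -mul_adj_mx -mulmxA Zr mulmx0.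
  by rewrite mul_scalar_mx !mxE.
rewrite -[LHS]mulr1.
apply: (@modspan_ind rs (fun x => x = 0) (fun b => phi (\det Z) * b)) rs1 => //.
- by move=> x y -> ->; rewrite addr0.
- by move=> c x ->; rewrite mulr0.
- by move=> x y; rewrite mulrDr.
- by move=> c x; rewrite mulrCA.
- by move=> x /rsr[i ->].
Qed.

Lemma integral_image (Q : comNzRingType) (psi : {rmorphism Q -> R}) :
  (forall q, integralOver phi (psi q)) -> (forall r, integralOver psi r) ->
  forall r, integralOver phi r.
Proof.
move=> H1 H2 r; have [p p_mon pr] := H2 r.
apply: (integral_root_monic (p := map_poly psi p)) pr _; first exact: monic_map.
by apply/integral_poly => i; rewrite coef_map; apply: H1.
Qed.
End ModuleSpan.

Lemma fin_gen_modspan (k : fieldType) (R : comAlgType k) (P : comNzRingType)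
    (phi : {rmorphism P -> R}) :
  fin_gen R -> (forall l : k, exists p, phi p = l%:A) -> (forall r, integralOver phi r) ->
  exists rs, forall a, modspan phi rs a.
Proof.
move=> [n [g gen]] scal int.
have [rs [rs1 Hrs]] := integral_modspan (codom g) int.
exists rs => a; rewrite -[a]mulr1.
have /(_ 1 rs1) // : forall b, modspan phi rs b -> modspan phi rs (a * b).
apply: (gen (fun a => forall b, modspan phi rs b -> modspan phi rs (a * b))).
- by move=> l b Hb; have [p <-] := scal l; apply: modspanZ.
- by move=> x y Hx Hy b Hb; rewrite mulrDl; apply: modspanD; auto.
- by move=> x y Hx Hy b Hb; rewrite -mulrA; auto.
- by move=> i b; apply: Hrs; apply: codom_f.
Qed.

(** * Noether normalization in dimension one *)

Lemma digits_inj r n (f g : 'I_n -> nat) :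
  (forall i, f i < r)%N -> (forall i, g i < r)%N ->
  (\sum_(i < n) f i * r ^ i = \sum_(i < n) g i * r ^ i)%N -> f =1 g.
Proof.
elim: n f g => [|n IH] f g fr gr; first by move=> _ [].
have shift (h : 'I_n.+1 -> nat) : (\sum_(i < n.+1) h i * r ^ i =
    h ord0 + r * \sum_(i < n) h (lift ord0 i) * r ^ i)%N.
  rewrite big_ord_recl expn0 muln1 big_distrr /=; congr addn.
  by apply: eq_bigr => i _; rewrite /bump leq0n add1n expnS mulnCA.
rewrite !shift => E.
have r0 : (0 < r)%N by apply: leq_ltn_trans (fr ord0).
have e0 : f ord0 = g ord0.
  by move/(congr1 (modn^~ r)): E; rewrite !(addnC (_ ord0)) !(mulnC r) !modnMDl !modn_small.
have : f \o lift ord0 =1 g \o lift ord0.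
  apply: IH => [i|i|]; [exact: fr|exact: gr|].
  by apply/eqP; rewrite -(eqn_pmul2l r0) -(eqn_add2l (f ord0)) E e0.
by move=> H i; case: (unliftP ord0 i) => [j ->|-> //]; apply: H.
Qed.

Section Normalization.
Variables (k : fieldType) (R : comAlgType k).

Definition evalR d (y : 'I_d -> R) : {mpoly k[d]} -> R := mmap (in_alg R) y.
HB.instance Definition _ d (y : 'I_d -> R) := GRing.RMorphism.on (evalR y).

Lemma evalRX d (y : 'I_d -> R) i : evalR y 'X_i = y i.
Proof. by rewrite /evalR mmapX mmap1U. Qed.

Lemma evalRC d (y : 'I_d -> R) (l : k) : evalR y l%:MP = l%:A.
Proof. by rewrite /evalR mmapC. Qed.

(** The coefficients u, v of [dim_le1_identity] lie in R and need not be visible polynomials. On a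
    finite generating family, multiplication by them is given by matrices over the polynomial ring;
    the identity becomes a matrix [Z] killing the family, and det Z is the relation. *)
Lemma dim_relation d (y : 'I_d.+2 -> R) : pure_dim_one R -> fin_gen R ->
  (forall r, integralOver (evalR y) r) -> exists2 G, G != 0 & evalR y G = 0.
Proof.
move=> dimR fgR int; pose i1 : 'I_d.+2 := lift ord0 ord0.
have [m [u [v Huv]]] := dim_le1_identity dimR (y ord0) (y i1).
have [|rs Hrs] := fin_gen_modspan fgR _ int.
  by move=> l; exists l%:MP; apply: evalRC.
pose n := size rs; pose r (i : 'I_n) := rs`_i.
have mat w : exists W : 'M_n, forall i, \sum_j evalR y (W i j) * r j = w * r i.
  have [C HC] := choice (fun i => modspanP (Hrs (w * r i))).
  by exists (\matrix_(i, j) C i j) => i; rewrite [RHS]HC; apply: eq_bigr => j _; rewrite mxE.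
have [U HU] := mat u; have [V HV] := mat v.
pose X0 : {mpoly k[d.+2]} := 'X_ord0; pose X1 : {mpoly k[d.+2]} := 'X_i1.
pose Y := X1 ^+ m *: (1%:M + X1 *: V) + X0 *: U.
pose Z := X0 ^+ m *: Y.
exists (\det Z); last first.
  apply: (det_trick (Hrs 1) (r := r)).
    by move=> x /(nthP 0)[i ilt <-]; exists (Ordinal ilt).
  move=> i; rewrite -[RHS](mul0r (r i)) -[X in _ = X * _]Huv.
  transitivity (evalR y X0 ^+ m * (evalR y X1 ^+ m * (r i + evalR y X1 * \sum_j evalR y (V i j) * r j)
     + evalR y X0 * \sum_j evalR y (U i j) * r j)); last first.
    by rewrite HU HV !evalRX; ring.
  have -> : r i = \sum_j (i == j)%:R * r j.
    by rewrite (bigD1 i) //= eqxx mul1r big1 ?addr0 // => j ji; rewrite eq_sym (negbTE ji) mul0r.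
  rewrite !mulr_sumr -big_split /= mulr_sumr -big_split /= mulr_sumr.
  apply: eq_bigr => j _; rewrite !mxE.
  rewrite !(rmorphM, rmorphD, rmorphXn) /= rmorph_nat; ring.
(* [kill a] sets X_a to 0. It shows det Z nonzero: with X0^m factored out, X0 = 0 leaves X1^m (1 +
   X1 V), and with X1^m cancelled, X1 = 0 leaves the identity matrix. *)
pose kill (a : 'I_d.+2) : {rmorphism {mpoly k[d.+2]} -> {mpoly k[d.+2]}} :=
  mmap (@mpolyC _ k) (fun i => if i == a then 0 else 'X_i).
have killX a i : kill a 'X_i = if i == a then 0 else 'X_i by rewrite /= mmapX mmap1U.
have n1 : X1 != 0 by rewrite -msupp_eq0 msuppX.
have n0 : X0 != 0 by rewrite -msupp_eq0 msuppX.
have K0 : map_mx (kill ord0) Y = X1 ^+ m *: (1%:M + X1 *: map_mx (kill ord0) V).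
  rewrite map_mxD !map_mxZ map_mxD map_mxZ map_mx1 rmorphXn.
  by rewrite (killX _ ord0) (killX _ i1) eqxx scale0r addr0.
have K1 : map_mx (kill i1) (1%:M + X1 *: map_mx (kill ord0) V) = 1%:M.
  by rewrite map_mxD map_mxZ map_mx1 (killX _ i1) eqxx scale0r addr0.
rewrite detZ mulf_neq0 ?expf_neq0 //.
apply: contraTneq isT => /(congr1 (kill ord0)).
rewrite -det_map_mx K0 rmorph0 => /eqP.
rewrite detZ mulf_eq0 !expf_eq0 (negbTE n1) !andbF /= => /eqP /(congr1 (kill i1)).
by rewrite -det_map_mx K1 rmorph0 det1 => /eqP; rewrite oner_eq0.
Qed.

Lemma integral_evalR (P : comNzRingType) (phi : {rmorphism P -> R}) d (y : 'I_d -> R) :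
  (forall l : k, integralOver phi l%:A) -> (forall i, integralOver phi (y i)) ->
  forall q, integralOver phi (evalR y q).
Proof.
move=> Hk Hy q; rewrite /evalR /mmap.
have H1 := integral1 phi; have HM := @integral_mul _ _ phi.
apply: (big_ind (integralOver phi)) => [|x z|m _]; [exact: integral0|exact: integral_add|].
apply: (HM); first exact: Hk.
rewrite /mmap1; apply: (big_ind (integralOver phi)) => [//||i _]; first exact: HM.
by elim: (m i) => [|j IH]; rewrite ?expr0 // exprS; apply: (HM).
Qed.

Section IntegralPolys.
Variables (P : comNzRingType) (phi : {rmorphism P -> R}).
Definition intpred : {pred R} := fun z => `[< integralOver phi z >].
Lemma intpred_subring : subring_closed intpred.
Proof.
split=> [|x y /asboolP Hx /asboolP Hy|x y /asboolP Hx /asboolP Hy]; apply/asboolP.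
- exact: integral1.
- exact: integral_sub.
- exact: integral_mul.
Qed.
HB.instance Definition _ := GRing.isSubringClosed.Build R intpred intpred_subring.
Definition intpred_closed : subringClosed R := intpred.
End IntegralPolys.

(* Nagata's substitution y_i = y'_i + t^(r^i): distinct monomials of G acquire
   distinct degrees in t, so that G(y) = 0 becomes monic in t up to a scalar. *)
Lemma nagata d (y : 'I_d.+1 -> R) G : G != 0 -> evalR y G = 0 ->
  (forall r, integralOver (evalR y) r) ->
  exists y' : 'I_d -> R, forall r, integralOver (evalR y') r.
Proof.
(* Every exponent in G is below [msize G], so the weight [w m] is a base r expansion and determines
   m. *)
move=> G0 Gy int; pose r := msize G; pose t := y ord0.
pose y' (i : 'I_d) := y (lift ord0 i) - t ^+ (r ^ i.+1).
exists y'; apply: integral_image int; set phi := evalR y'.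
have inty' i : integralOver phi (y' i) by rewrite -[y' i]evalRX; apply: integral_id.
have intk (l : k) : integralOver phi l%:A by rewrite -(evalRC y'); apply: integral_id.
pose K := intpred_closed phi.
pose pm (m : 'X_{1..d.+1}) : {poly R} := 'X ^+ m ord0 *
  \prod_(i < d) ((y' i)%:P + 'X^(r ^ i.+1)) ^+ m (lift ord0 i).
pose w (m : 'X_{1..d.+1}) := (\sum_(i < d.+1) m i * r ^ i)%N.
have r0 : (0 < r)%N by rewrite lt0n msize_poly_eq0.
have fac_mon i : ((y' i)%:P + 'X^(r ^ i.+1)) \is monic /\
   size ((y' i)%:P + 'X^(r ^ i.+1) : {poly R}) = (r ^ i.+1).+1.
  have lt : (size ((y' i)%:P : {poly R}) < size ('X^(r ^ i.+1) : {poly R}))%N.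
    rewrite size_polyXn; apply: leq_ltn_trans (size_polyC_leq1 _) _.
    by rewrite ltnS expn_gt0 r0.
  rewrite addrC; split; last by rewrite size_polyDl // size_polyXn.
  by rewrite monicE lead_coefDl // lead_coefXn.
have pm_mon m : pm m \is monic.
  apply: rpredM; first by apply: rpredX; apply: monicX.
  by apply: rpred_prod => i _; apply/rpredX/(fac_mon i).1.
have pm_size m : size (pm m) = (w m).+1.
  rewrite /pm size_monicM ?rpredX ?monicX //; last first.
    by rewrite monic_neq0 // rpred_prod // => i _; apply/rpredX/(fac_mon i).1.
  rewrite size_polyXn addSn /=.
  have exp_size (q : {poly R}) j : q \is monic -> (size (q ^+ j)).-1 = ((size q).-1 * j)%N.
    move=> qm; elim: j => [|j IH]; first by rewrite muln0 expr0 size_poly1.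
    rewrite exprS size_monicM ?monic_neq0 ?rpredX // mulnS -IH.
    have : (0 < size (q ^+ j))%N by rewrite size_poly_gt0 monic_neq0 // rpredX.
    have : (0 < size q)%N by rewrite size_poly_gt0 monic_neq0.
    by case: (size q) (size (q ^+ j)) => [|a] [|b] //; rewrite addSn addnS.
  have prod_size (I : seq 'I_d) (F : 'I_d -> {poly R}) : (forall i, F i \is monic) ->
     size (\prod_(i <- I) F i) = (\sum_(i <- I) (size (F i)).-1).+1.
    move=> Fm; elim: I => [|i I IH]; first by rewrite !big_nil size_poly1.
    rewrite !big_cons size_monicM //; last by rewrite monic_neq0 // rpred_prod.
    have : (0 < size (F i))%N by rewrite size_poly_gt0 monic_neq0.
    by rewrite IH; case: (size (F i)) => // a _; rewrite addSn addnS.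
  rewrite prod_size => [|i]; last exact/rpredX/(fac_mon i).1.
  rewrite addnS /w big_ord_recl expn0 muln1; congr (_ + _).+1.
  apply: eq_bigr => i _; rewrite exp_size; last exact: (fac_mon i).1.
  by rewrite (fac_mon i).2 mulnC.
have pm_int m : pm m \is a polyOver K.
  apply: rpredM; first by apply: rpredX; apply: polyOverX.
  apply: rpred_prod => i _; apply: rpredX; apply: rpredD; last exact: polyOverXn.
  by rewrite polyOverC; apply/asboolP.
have pm_eval m : (pm m).[t] = mmap1 y m.
  rewrite /pm hornerM hornerXn horner_prod /mmap1 big_ord_recl; congr (_ * _).
  by apply: eq_bigr => i _; rewrite horner_exp hornerD hornerC hornerXn subrK.
pose F := \sum_(m <- msupp G) (G@_m)%:A *: pm m.
have Ft : F.[t] = 0.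
  rewrite -Gy /evalR /mmap /F horner_sum; apply: eq_bigr => m _.
  by rewrite hornerZ pm_eval.
have F_int : F \is a polyOver K.
  apply: rpred_sum => m _; apply: polyOverZ => //; exact/asboolP.
have [m0 m0s m0max] : exists2 m0, m0 \in msupp G &
    forall m, m \in msupp G -> m != m0 -> (w m < w m0)%N.
  have w_inj m m' : m \in msupp G -> m' \in msupp G -> w m = w m' -> m = m'.
    move=> ms ms' e; apply/mnmP; apply: (digits_inj (r := r)) e => i.
      apply: leq_ltn_trans (msize_mdeg_lt ms).
      by rewrite mdegE (bigD1 i) //= leq_addr.
    apply: leq_ltn_trans (msize_mdeg_lt ms').
    by rewrite mdegE (bigD1 i) //= leq_addr.
  have : msupp G != [::] by rewrite msupp_eq0.
  move: w_inj; elim: (msupp G) => // m s IH inj _.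
  have [->|s0] := eqVneq s [::].
    by exists m; rewrite ?inE // => m'; rewrite inE => /eqP -> /eqP.
  have [|m0 m0s H] := IH _ s0.
    by move=> a b sa sb; apply: inj; rewrite inE ?sa ?sb orbT.
  have [e|ne] := eqVneq m m0.
    exists m0 => [|m']; first by rewrite inE m0s orbT.
    by rewrite inE e => /orP[/eqP ->|/H//]; rewrite eqxx.
  have [lt|ge] := ltnP (w m) (w m0).
    exists m0 => [|m']; first by rewrite inE m0s orbT.
    by rewrite inE => /orP[/eqP -> //|]; apply: H.
  have lt : (w m0 < w m)%N.
    rewrite ltn_neqAle ge andbT; apply: contraNneq ne => e.
    by apply/eqP/inj; rewrite ?inE ?eqxx ?m0s ?orbT.
  exists m => [|m']; first by rewrite inE eqxx.
  rewrite inE => /orP[/eqP ->|m's _]; first by rewrite eqxx.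
  by have [->//|/(H _ m's)/ltn_trans] := eqVneq m' m0; apply.
pose c := G@_m0; have c0 : c != 0 by rewrite -mcoeff_msupp.
have cu : c^-1%:A * c%:A = 1 :> R by rewrite mulr_algl scalerA mulVf // scale1r.
(* Only [m0], the monomial of largest weight, reaches the top degree, so dividing by its coefficient
   gives a monic equation for t with integral coefficients. *)
pose F1 := c^-1%:A *: F.
have F1E : F1 = pm m0 + \sum_(m <- rem m0 (msupp G)) (c^-1%:A * (G@_m)%:A) *: pm m.
  rewrite /F1 /F (perm_big _ (perm_to_rem m0s)) big_cons scalerDr scalerA cu scale1r.
  by rewrite scaler_sumr; congr (_ + _); apply: eq_bigr => m _; rewrite scalerA.
have small : (size (\sum_(m <- rem m0 (msupp G)) (c^-1%:A * (G@_m)%:A) *: pm m)%R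
     < size (pm m0))%N.
  rewrite pm_size ltnS big_seq; apply: (big_ind (fun q : {poly R} => size q <= w m0)%N).
  - by rewrite size_poly0.
  - by move=> p q ps qs; apply: leq_trans (size_polyD _ _) _; rewrite geq_max ps qs.
  move=> m; rewrite (rem_filter _ (msupp_uniq G)) mem_filter => /andP[/= mm0 ms].
  by apply: leq_trans (size_scale_leq _ _) _; rewrite pm_size; apply: m0max.
have intt : integralOver phi t.
  apply: (integral_root_monic (p := F1)).
  - by rewrite monicE F1E lead_coefDl // (monicP (pm_mon _)).
  - by rewrite /root /F1 hornerZ Ft mulr0.
  have F1_int : F1 \is a polyOver K by apply: polyOverZ => //; exact/asboolP.
  by apply/integral_poly => i; have /polyOverP/(_ i)/asboolP := F1_int.
have intX j : integralOver phi (t ^+ j).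
  elim: j => [|j IH]; first exact: integral1.
  by rewrite exprS; apply: integral_mul.
apply: integral_evalR => // i.
case: (unliftP ord0 i) => [j ->|->]; last exact: intt.
rewrite -(subrK (t ^+ (r ^ j.+1)) (y _)).
by apply: integral_add; [exact: inty'|exact: intX].
Qed.

(** While two or more variables remain, [dim_relation] and [nagata] remove one. With no variable
    left, R is integral over k and x = 0 will do. *)
Lemma noether_normalization : pure_dim_one R -> fin_gen R ->
  exists x : R, forall r, integralOver (horner_alg x) r.
Proof.
move=> dimR fgR.
have [d [y int]] : exists d (y : 'I_d -> R), forall r, integralOver (evalR y) r.
  case: (fgR) => n [g gen]; exists n, g => r.
  have [q <-] : exists q, evalR g q = r; last exact: integral_id.
  apply: (gen (fun r => exists q, evalR g q = r)).
  - by move=> l; exists l%:MP; apply: evalRC.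
  - by move=> _ _ [p <-] [q <-]; exists (p + q); rewrite rmorphD.
  - by move=> _ _ [p <-] [q <-]; exists (p * q); rewrite rmorphM.
  - by move=> i; exists 'X_i; rewrite evalRX.
have base x (z : 'I_d -> R) : (forall i, z i = x) ->
   forall q, integralOver (horner_alg x) (evalR z q).
  move=> zx; apply: integral_evalR => [l|i].
    by rewrite -(horner_algC x); apply: integral_id.
  by rewrite zx -[x in integralOver _ x](horner_algX x); apply: integral_id.
elim: d y int base => [|d IH] y int base.
  by exists 0; apply: integral_image int; apply: base => -[].
case: d IH y int base => [|d] IH y int base.
  exists (y ord0); apply: integral_image int; apply: base => i.
  by rewrite (ord1 i).
have [G G0 Gy] := dim_relation dimR fgR int.
have [y' int'] := nagata G0 Gy int.
apply: (IH y' int') => x z zx; apply: integral_evalR => [l|i].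
  by rewrite -(horner_algC x); apply: integral_id.
by rewrite zx -[x in integralOver _ x](horner_algX x); apply: integral_id.
Qed.
End Normalization.

(** * Free bases over the polynomial ring *)

Section FiniteOverPoly.
Variables (k : fieldType) (R : comAlgType k) (x : R).
Hypotheses (redR : reduced R) (dimR : pure_dim_one R) (fgR : fin_gen R).
Hypothesis int : forall r, integralOver (horner_alg x) r.
Let h : {rmorphism {poly k} -> R} := horner_alg x.
Implicit Types p q c : {poly k}.

Lemma poly_modspan : exists rs, forall a, modspan h rs a.
Proof.
by apply: (fin_gen_modspan (phi := h)) => // l; exists l%:P; rewrite /= horner_algC.
Qed.

Definition multiples (a : R) : R -> Prop := fun z => exists w, z = a * w.

Lemma multiples_ideal a : is_ideal (multiples a).
Proof.
split; first by exists 0; rewrite mulr0.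
split=> [_ _ [u ->] [v ->]|r _ [u ->]]; first by exists (u + v); rewrite mulrDr.
by exists (r * u); rewrite mulrCA.
Qed.

Lemma poly_quotient_finite p : p != 0 ->
  exists vs, forall a, inspan (multiples (h p)) vs a.
Proof.
move=> p0; have [rs Hrs] := poly_modspan.
pose vs := [seq x ^+ i * r | i <- iota 0 (size p), r <- rs].
have sU := is_ideal_submod (multiples_ideal (h p)).
have [N0 ND NZ] := inspan_submod vs sU.
exists vs => a; have [c ->] := modspanP (Hrs a).
elim/big_ind: _ => // i _; rewrite (divp_eq (c i) p) rmorphD rmorphM mulrDl.
apply: (ND).
  by apply: inspan_base => //; exists (h (c i %/ p) * rs`_i); ring.
have lt : (size (c i %% p)%R < size p)%N by rewrite ltn_modp.
rewrite -[(c i %% p)%R]coefK poly_def rmorph_sum mulr_suml.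
elim/big_ind: _ => // j _; rewrite -mul_polyC rmorphM rmorphXn /= horner_algC horner_algX.
rewrite -mulrA mulr_algl; apply/NZ/inspan_mem => //.
apply/allpairsP; exists (nat_of_ord j, rs`_i); split=> //=; last exact: mem_nth.
by rewrite mem_iota /= add0n (ltn_trans (ltn_ord j)).
Qed.

(** Otherwise h p lies in a minimal prime P, and R/P is finite over k. For q in a prime Q above P
    but not in P, Fitting's relation puts q^m (1 - q s) in P, hence 1 - q s in P and in Q, which is
    absurd. *)
Lemma poly_torsion_free p y : p != 0 -> h p * y = 0 -> y = 0.
Proof.
move=> p0 py; apply: contrapT => /eqP y0.
have [P mP Py] := reduced_minimal_prime redR y0.
have [[idP [P1 PP]] _] := mP; have [P0 [PD PM]] := idP.
have Pp : P (h p) by case: (PP (h p) y) => //; rewrite py.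
have [[Q [[idQ [Q1 _]] [PQ [q [Qq nPq]]]]] _] := dimR mP.
have [vs Hvs] := poly_quotient_finite p0.
have [m [s [w E]]] := inspan_fitting q (multiples_ideal _) Hvs.
have nPX j : ~ P (q ^+ j).
  by elim: j => [|j IH]; rewrite ?expr0 // exprS => /PP[].
have [|/PQ] : P (q ^+ m) \/ P (1 - q * s).
- apply: PP; have -> : q ^+ m * (1 - q * s) = h p * w by rewrite -[RHS]E exprSr; ring.
  by rewrite mulrC; apply: PM.
- exact: nPX.
case: idQ => Q0 [QD QM] Q1s; apply: Q1.
have -> : 1 = (1 - q * s) + s * q by ring.
by apply: QD => //; apply: QM.
Qed.

Definition spans n (r : 'I_n -> R) := forall a, exists c : 'I_n -> {poly k},
  a = \sum_i h (c i) * r i.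

(** A spanning family with the fewest elements is free: Euclid's algorithm on a relation lowers the
    size of a nonzero coefficient by changing generators, until some generator vanishes by
    [poly_torsion_free], against minimality. *)
Lemma poly_basis : exists n (r : 'I_n.+1 -> R), spans r /\
  forall c : 'I_n.+1 -> {poly k}, \sum_i h (c i) * r i = 0 -> forall i, c i = 0.
Proof.
pose has_span n := `[< exists r : 'I_n -> R, spans r >].
have ex : exists n, has_span n.
  have [rs Hrs] := poly_modspan; exists (size rs); apply/asboolP.
  by exists (fun i => rs`_i) => a; apply/modspanP/Hrs.
case: (ex_minnP ex) => -[|n] /asboolP[r0 Hr0] min.
  by have [c] := Hr0 1; rewrite big_ord0 => /eqP; rewrite oner_eq0.
exists n, r0; split=> // c rel i; apply: contrapT => /eqP ci0.
move: {2}(size (c i)) (leqnn (size (c i))) => D.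
elim: D r0 Hr0 c rel i ci0 => [|D IH] r Hr c rel i ci0 sD.
  by rewrite leqn0 size_poly_eq0 (negbTE ci0) in sD.
(* Adding to r_i the r_j weighted by the quotients c_j %/ c_i turns every other coefficient c_j of
   the relation into its remainder modulo c_i. *)
pose r' j := if j == i then r i + \sum_(j < n) h (c (lift i j) %/ c i)%R * r (lift i j) else r j.
have ri : r' i = r i + \sum_(j < n) h (c (lift i j) %/ c i)%R * r (lift i j).
  by rewrite /r' eqxx.
have rl j : r' (lift i j) = r (lift i j) by rewrite /r' eq_sym (negbTE (neq_lift _ _)).
have D1 (F : 'I_n.+1 -> R) : \sum_j F j = F i + \sum_(j < n) F (lift i j).
  exact: (bigD1_ord i).
have span' : spans r'.
  move=> a; have [d ->] := Hr a.
  exists (fun j => if unlift i j is Some j' then d j - d i * (c j %/ c i)%R else d i).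
  rewrite !D1 unlift_none ri mulrDr -addrA; congr (_ + _).
  rewrite mulr_sumr -big_split; apply: eq_bigr => j _ /=.
  by rewrite liftK rl rmorphB rmorphM /=; ring.
have rel' : h (c i) * r' i + \sum_(j < n) h (c (lift i j) %% c i)%R * r' (lift i j) = 0.
  rewrite -[RHS]rel D1 ri mulrDr -addrA; congr (_ + _).
  rewrite mulr_sumr -big_split; apply: eq_bigr => j _ /=.
  by rewrite rl {3}(divp_eq (c (lift i j)) (c i)) rmorphD rmorphM /=; ring.
have [[j j0]|N] := pselect (exists j, (c (lift i j) %% c i)%R != 0).
  apply: (IH r' span' (fun l => if unlift i l is Some l' then (c l %% c i)%R else c i) _ (lift i j)).
  - rewrite -[RHS]rel' D1 unlift_none; congr (_ + _).
    by apply: eq_bigr => l _; rewrite liftK.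
  - by rewrite liftK.
  by rewrite liftK -ltnS; apply: leq_trans sD; rewrite ltn_modp.
have ri0 : r' i = 0.
  apply: (poly_torsion_free ci0); rewrite -[RHS]rel' big1 ?addr0 // => j _.
  have -> : (c (lift i j) %% c i)%R = 0.
    by apply/eqP; apply: contrapT => /negP ?; apply: N; exists j.
  by rewrite rmorph0 mul0r.
have : has_span n.
  apply/asboolP; exists (fun j => r' (lift i j)) => a.
  have [d ->] := span' a; exists (fun j => d (lift i j)).
  by rewrite D1 ri0 mulr0 add0r.
by move/min; rewrite ltnn.
Qed.
End FiniteOverPoly.

(** * The trace form *)

Lemma idempotent_base (F : fieldType) n m (C : 'M[F]_(n, m)) (B : 'M_(m, n)) C' B' :
  C' *m C = 1%:M -> B *m B' = 1%:M -> (C *m B) *m (C *m B) = C *m B -> B *m C = 1%:M.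
Proof.
move=> HC HB /(congr1 (fun M => C' *m M *m B')).
by rewrite !mulmxA HC !mul1mx -!mulmxA HB !mulmx1.
Qed.

(** The trace of an idempotent is its rank: in a full rank factorization A = C B, idempotence gives
    B C = 1. *)
Lemma idempotent_trace (F : fieldType) n (A : 'M[F]_n) :
  [pchar F] =i pred0 -> A *m A = A -> \tr A = 0 -> A = 0.
Proof.
move=> char0 A2; have [C' HC] := row_fullP (col_base_full A).
have [B' HB] := row_freeP (row_base_free A).
have BC := idempotent_base HC HB; rewrite mulmx_base in BC.
rewrite -{1}(mulmx_base A) mxtrace_mulC BC // mxtrace1 => /eqP.
by rewrite (pcharf0P _).1 // mxrank_eq0 => /eqP.
Qed.

(** The monic equation of a is T^l g with g(0) = c nonzero, and g(a) = a G + h c. *)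
Lemma integral_trailing (k : fieldType) (R : comAlgType k) (h : {rmorphism {poly k} -> R}) a :
  integralOver h a -> exists (G : R) c l, c != 0 /\ (a * G + h c) * a ^+ l = 0.
Proof.
move=> [f fm fa].
have [l [g]] := multiplicity_XsubC f 0; rewrite monic_neq0 //= subr0 => g0 fE.
have [G [c [c0 Gc]]] : exists (G : R) c, c != 0 /\ (map_poly h g).[a] = a * G + h c.
  move: g0 {fE}; elim/poly_ind: g => [|g c _]; first by rewrite root0.
  rewrite /root !hornerE => c0; exists (map_poly h g).[a], c; split=> //.
  by rewrite rmorphD rmorphM /= map_polyX map_polyC !hornerE mulrC.
exists G, c, l; split=> //.
by move: fa; rewrite fE rmorphM rmorphXn /= map_polyX /root !hornerE Gc => /eqP.
Qed.

Section FreeExtension.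
Variables (k : fieldType) (R : comAlgType k) (h : {rmorphism {poly k} -> R}).
Variables (n : nat) (r : 'I_n.+1 -> R).
Hypotheses (char0 : [pchar k] =i pred0) (redR : reduced R).
Hypotheses (span_r : forall a, exists c : 'I_n.+1 -> {poly k}, a = \sum_i h (c i) * r i)
  (ind_r : forall c : 'I_n.+1 -> {poly k}, \sum_i h (c i) * r i = 0 -> forall i, c i = 0)
  (tf : forall p y, p != 0 -> h p * y = 0 -> y = 0)
  (int : forall a, integralOver h a).
Implicit Types (p q c e : {poly k}) (a b y : R).

Lemma span_row a : exists v : 'rV[{poly k}]_n.+1, a = \sum_i h (v 0 i) * r i.
Proof.
have [c aE] := span_r a; exists (\row_i c i); rewrite {1}aE.
by apply: eq_bigr => i _; rewrite mxE.
Qed.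

Definition co a : 'rV[{poly k}]_n.+1 := sval (cid (span_row a)).

Lemma coE a : a = \sum_i h (co a 0 i) * r i.
Proof. exact: svalP (cid (span_row a)). Qed.

Lemma co_uniq a (v : 'rV_n.+1) : a = \sum_i h (v 0 i) * r i -> co a = v.
Proof.
move=> aE; apply/rowP => i; apply/eqP; rewrite -subr_eq0; apply/eqP.
apply: (ind_r (c := fun i => co a 0 i - v 0 i)) i.
under eq_bigr do rewrite rmorphB mulrBl.
by rewrite sumrB -coE -aE subrr.
Qed.

Lemma coD a b : co (a + b) = co a + co b.
Proof.
apply: co_uniq; rewrite {1}(coE a) {1}(coE b) -big_split; apply: eq_bigr => i _.
by rewrite mxE rmorphD mulrDl.
Qed.

Lemma coZ p a : co (h p * a) = p *: co a.
Proof.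
apply: co_uniq; rewrite {1}(coE a) mulr_sumr; apply: eq_bigr => i _.
by rewrite mxE rmorphM mulrA.
Qed.

Definition mu a : 'M[{poly k}]_n.+1 := \matrix_(i, j) co (a * r i) 0 j.

Lemma coM a b : co (b * a) = co b *m mu a.
Proof.
apply: co_uniq; rewrite {1}(coE b) mulr_suml.
under eq_bigr do rewrite -mulrA [r _ * a]mulrC {1}(coE (a * r _)) mulr_sumr.
rewrite exchange_big; apply: eq_bigr => j _ /=.
rewrite mxE rmorph_sum mulr_suml; apply: eq_bigr => i _.
by rewrite rmorphM mxE mulrA.
Qed.

Lemma mu_row a i : row i (mu a) = co (a * r i).
Proof. by apply/rowP => j; rewrite !mxE. Qed.

Lemma muM a b : mu (a * b) = mu a *m mu b.
Proof.
by apply/row_matrixP => i; rewrite row_mul !mu_row -coM; congr co; ring.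
Qed.

Lemma muD a b : mu (a + b) = mu a + mu b.
Proof. by apply/matrixP => i j; rewrite !mxE mulrDl coD mxE. Qed.

Lemma muZ p a : mu (h p * a) = p *: mu a.
Proof. by apply/matrixP => i j; rewrite !mxE -mulrA coZ mxE. Qed.

Lemma co_r i : co (r i) = delta_mx 0 i.
Proof.
apply: co_uniq; rewrite (bigD1 i) //= mxE !eqxx rmorph1 mul1r big1 ?addr0 // => j ji.
by rewrite mxE (negbTE ji) andbF rmorph0 mul0r.
Qed.

Lemma mu1 : mu 1 = 1%:M.
Proof.
by apply/row_matrixP => i; rewrite mu_row mul1r co_r row1.
Qed.

Lemma muX a m : mu (a ^+ m) = mu a ^+ m.
Proof. by elim: m => [|m IH]; rewrite ?mu1 // !exprS muM IH. Qed.

Lemma mu_const p : mu (h p) = p%:M.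
Proof. by rewrite -[h p]mulr1 muZ mu1 scalemx1. Qed.

Lemma mu_sum (F : 'I_n.+1 -> R) : mu (\sum_i F i) = \sum_i mu (F i).
Proof.
elim/big_rec2: _ => [|i y1 y2 _ <-]; last by rewrite muD.
by rewrite -(rmorph0 h) mu_const raddf0.
Qed.

Lemma co_inj a : co a = 0 -> a = 0.
Proof. by move=> e; rewrite (coE a) e big1 // => i _; rewrite mxE rmorph0 mul0r. Qed.

Lemma mu_inj a : mu a = 0 -> a = 0.
Proof.
move=> e; apply: co_inj.
by rewrite -[a]mul1r coM e mulmx0.
Qed.

Lemma natP_neq0 m : (m.+1%:R : {poly k}) != 0.
Proof. by rewrite -polyC_natr polyC_eq0 natk_neq0. Qed.

Lemma pchar_frac : [pchar {fraction {poly k}}] =i pred0.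
Proof.
apply/pcharf0P => m; rewrite -[m%:R](rmorph_nat (@tofrac {poly k})) tofrac_eq0.
by case: m => [|m]; rewrite ?eqxx // (negbTE (natP_neq0 m)).
Qed.

(** Reducedness improves a^l (a G + h c) = 0 to a (a G + h c) = 0. Then e = - a G satisfies e^2 = c
    e, so e / c is a nonzero idempotent over the fraction field of k[x], and its trace is nonzero in
    characteristic 0. *)
Lemma trace_nondegenerate a : a != 0 -> exists b, \tr (mu (a * b)) != 0.
Proof.
move=> a0; have [G [c [l [c0 E]]]] := integral_trailing (int a).
have aE : h c * a = a * (a * - G).
  have : a * (a * G + h c) = 0.
    apply: (redR (n := l.+1)); rewrite exprMn !exprS.
    have -> : a * a ^+ l * ((a * G + h c) * (a * G + h c) ^+ l) =
      a * (a * G + h c) ^+ l * ((a * G + h c) * a ^+ l) by ring.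
    by rewrite E mulr0.
  by move/eqP; rewrite mulrDr addrC addr_eq0 => /eqP; rewrite mulrC => ->; ring.
exists (- G); set e := a * - G in aE *.
have e2 : e * e = h c * e by rewrite {1}/e mulrAC -aE /e; ring.
have e0 : mu e != 0.
  apply: contraNneq a0 => /mu_inj e0.
  by apply/eqP/(tf c0); rewrite aE e0 mulr0.
have E2 : mu e *m mu e = c *: mu e by rewrite -muM e2 muZ.
apply: contraNneq e0 => tr0.
pose A := (tofrac c)^-1 *: map_mx (@tofrac _) (mu e).
have cf0 : tofrac c != 0 by rewrite tofrac_eq0.
have A2 : A *m A = A.
  rewrite -scalemxAl -scalemxAr -map_mxM E2 map_mxZ !scalerA mulVf // mulr1 //.
have : A = 0.
  apply: idempotent_trace => //; first exact: pchar_frac.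
  by rewrite mxtraceZ trace_map_mx tr0 rmorph0 mulr0.
move/(congr1 (fun B => tofrac c *: B)); rewrite scalerA mulfV // scale1r scaler0.
move/matrixP => Z; apply/eqP/matrixP => i j; rewrite [RHS]mxE.
by have /eqP := Z i j; rewrite [X in X == _]mxE [X in _ == X]mxE tofrac_eq0 => /eqP.
Qed.

Definition trace_form : 'M[{poly k}]_n.+1 := \matrix_(i, j) \tr (mu (r i * r j)).
Definition disc : {poly k} := \det trace_form.

Lemma trace_form_co a j : (co a *m trace_form) 0 j = \tr (mu (a * r j)).
Proof.
rewrite mxE {2}(coE a) mulr_suml.
rewrite mu_sum raddf_sum; apply: eq_bigr => i _.
by rewrite -mulrA muZ /= mxtraceZ mxE.
Qed.

(** A row vector killed by the form is the coordinate vector of an element orthogonal to all of R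
    for the trace. *)
Lemma disc_neq0 : disc != 0.
Proof.
apply/negP => /det0P[v v0 vD].
pose a := \sum_i h (v 0 i) * r i.
have aE : co a = v by apply: co_uniq.
have a0 : a != 0.
  apply: contraNneq v0 => a0; rewrite -aE a0; apply/eqP.
  by rewrite -(rmorph0 h) -[h 0]mulr1 coZ scale0r.
have [b /eqP] := trace_nondegenerate a0; apply.
rewrite {1}(coE b) mulr_sumr.
rewrite mu_sum raddf_sum big1 // => j _ /=.
by rewrite mulrCA muZ mxtraceZ -trace_form_co aE vD mxE mulr0.
Qed.
End FreeExtension.

(** * Almost integral elements *)

Section PolyDivisibility.
Variable k : fieldType.
Implicit Types u v C : {poly k}.

(** k[x] is completely integrally closed: once u / v is in lowest terms, every power of its
    denominator divides C, so the denominator is constant. *)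
Lemma dvdp_exp_bounded u v C : C != 0 -> (forall m, v ^+ m %| C * u ^+ m) -> v %| u.
Proof.
move=> C0 H; have [v0|v0] := eqVneq v 0.
  have := H 1; rewrite !expr1 v0 dvd0p mulf_eq0 (negbTE C0) /= => /eqP ->.
  exact: dvdp0.
set g := gcdp u v.
have g0 : g != 0 by rewrite gcdp_eq0 negb_and v0 orbT.
have uE : u = u %/ g * g by rewrite divpK // dvdp_gcdl.
have vE : v = v %/ g * g by rewrite divpK // dvdp_gcdr.
have cop : coprimep (v %/ g) (u %/ g).
  by rewrite coprimep_sym coprimep_div_gcd // v0 orbT.
have dvC m : (v %/ g) ^+ m %| C.
  have := H m; rewrite uE {1}vE !exprMn mulrA dvdp_mul2r ?expf_neq0 //.
  by rewrite mulrC Gauss_dvdpr // coprimep_expl // coprimep_expr.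
have v'0 : v %/ g != 0 by apply: contraNneq v0 => e; rewrite vE e mul0r.
suff /eqP : size (v %/ g) = 1%N.
  rewrite size_poly_eq1 => e1; rewrite vE [X in _ %| X]uE dvdp_mul2r //.
  by rewrite (eqp_dvdl _ e1) dvd1p.
have := dvdp_leq C0 (dvC (size C)).
rewrite -size_poly_gt0 in v'0.
case E : (size (v %/ g)) v'0 => [|[|s]] // _; rewrite leqNgt => /negP[].
have := size_exp (v %/ g) (size C); rewrite E /=.
have : (0 < size ((v %/ g) ^+ size C))%N.
  by rewrite size_poly_gt0 expf_neq0 // -size_poly_eq0 E.
case: (size ((v %/ g) ^+ size C)%R) => //= a _ ->; rewrite ltnS mulSn leq_addr //.
Qed.

(** Each coefficient of the remainder modulo d is a polynomial in l that vanishes at all integers,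
    which are infinitely many points of k in characteristic 0. *)
Lemma dvdp_family (char0 : [pchar k] =i pred0) n (v : 'I_n -> {poly k}) (d : {poly k}) :
  (forall l : k, d %| \sum_(i < n) l ^+ i *: v i) -> forall i, d %| v i.
Proof.
move=> H i; apply/modp_eq0P/polyP => j; rewrite coef0.
pose q := \poly_(i < n) (if insub i is Some i' then (v i' %% d)%R`_j else 0).
have qE (i' : 'I_n) : q`_i' = (v i' %% d)%R`_j by rewrite coef_poly ltn_ord valK.
rewrite -qE; suff -> : q = 0 by rewrite coef0.
apply/eqP; apply: contrapT => /negP q0.
have root_q l : root q l.
  apply/eqP; rewrite horner_poly.
  have /modp_eq0P/polyP/(_ j) := H l; rewrite coef0 => Hl; rewrite -[RHS]Hl.
  rewrite (big_morph (fun p => p %% d) (id1 := 0) (op1 := +%R)) ?mod0p //; last exact: modpD.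
  rewrite coef_sum; apply: eq_bigr => i' _.
  by rewrite valK modpZl coefZ mulrC.
suff : (size [seq (m%:R : k) | m <- iota 0 (size q)] < size q)%N.
  by rewrite size_map size_iota ltnn.
apply: max_poly_roots => //; first by apply/allP => l _; apply: root_q.
rewrite map_inj_uniq ?iota_uniq // => a b /eqP.
wlog le : a b / (a <= b)%N.
  by move=> W; have [/W//|/ltnW/W W' /eqP e] := leqP a b; apply/esym/W'/eqP/esym.
rewrite eq_sym -subr_eq0 -natrB // (pcharf0P _).1 // subn_eq0 => ba.
by apply/eqP; rewrite eqn_leq le.
Qed.
End PolyDivisibility.

Lemma horner_char_poly (P : comNzRingType) n (A : 'M[P]_n) a :
  (char_poly A).[a] = \det (a%:M - A).
Proof.
rewrite -[LHS]/(horner_eval a (char_poly A)) -det_map_mx; congr (\det _).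
apply/matrixP => i j; rewrite !mxE /= /horner_eval hornerD hornerN hornerC hornerMn hornerX.
by [].
Qed.

Section AlmostIntegral.
Variables (k : fieldType) (R : comAlgType k) (h : {rmorphism {poly k} -> R}).
Hypothesis tf : forall p y, p != 0 -> h p * y = 0 -> y = 0.
Implicit Types (p q c e C : {poly k}) (a b y z : R).

(* z / e is almost integral over R: all its powers lie in (1 / C) R for a fixed C. *)
Definition almost_int e z :=
  exists2 C, C != 0 & forall m, exists b, h C * z ^+ m = h e ^+ m * b.

Lemma almost_intD e z w : almost_int e z -> almost_int e w -> almost_int e (z + w).
Proof.
move=> [C C0 HC] [D D0 HD]; exists (C * D) => [|m]; first exact: mulf_neq0.
rewrite exprDn mulr_sumr.
elim/big_ind: _ => [|_ _ [u ->] [v ->]|i _].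
- by exists 0; rewrite mulr0.
- by exists (u + v); rewrite mulrDr.
have [u Hu] := HC (m - i)%N; have [v Hv] := HD i.
exists (u * v *+ 'C(m, i)); rewrite !mulrnAr; congr (_ *+ _).
have -> : h e ^+ m = h e ^+ (m - i) * h e ^+ i by rewrite -exprD subnK // -ltnS.
rewrite rmorphM mulrACA Hu Hv; ring.
Qed.

Lemma almost_intM e a z : almost_int e z -> almost_int e (a * z).
Proof.
move=> [C C0 HC]; exists C => // m; have [b Hb] := HC m.
by exists (a ^+ m * b); rewrite exprMn mulrCA Hb mulrCA.
Qed.

Lemma almost_int_base e a : almost_int e (h e * a).
Proof.
exists 1 => [|m]; first exact: oner_neq0.
by exists (a ^+ m); rewrite rmorph1 mul1r exprMn.
Qed.

Lemma almost_int_mul e e' z w :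
  almost_int e z -> almost_int e' w -> almost_int (e * e') (z * w).
Proof.
move=> [C C0 HC] [D D0 HD]; exists (C * D) => [|m]; first exact: mulf_neq0.
have [u Hu] := HC m; have [v Hv] := HD m; exists (u * v).
by rewrite !rmorphM !exprMn mulrACA Hu Hv mulrACA.
Qed.

Lemma cancel_h p y z : p != 0 -> h p * y = h p * z -> y = z.
Proof.
move=> p0 /eqP; rewrite -subr_eq0 -mulrBr => /eqP/(tf p0)/eqP.
by rewrite subr_eq0 => /eqP.
Qed.

Lemma almost_int_cancel e e' z : e' != 0 ->
  almost_int (e * e') (h e' * z) -> almost_int e z.
Proof.
move=> e0 [C C0 HC]; exists C => // m; have [b Hb] := HC m; exists b.
apply: (cancel_h (p := e' ^+ m)); first by rewrite expf_neq0.
rewrite rmorphXn; move: Hb; rewrite rmorphM !exprMn => Hb.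
by rewrite mulrCA Hb; ring.
Qed.

Variables (n : nat) (r : 'I_n.+1 -> R).
Hypotheses (char0 : [pchar k] =i pred0).
Hypotheses (span_r : forall a, exists c : 'I_n.+1 -> {poly k}, a = \sum_i h (c i) * r i)
  (ind_r : forall c : 'I_n.+1 -> {poly k}, \sum_i h (c i) * r i = 0 -> forall i, c i = 0).

(** Taking determinants in C z^m = e^m b gives C^(n+1) det(z)^m = e^(m(n+1)) det(b) for all m, where
    [dvdp_exp_bounded] applies. *)
Lemma almost_int_det e z : almost_int e z -> e ^+ n.+1 %| \det (mu span_r z).
Proof.
move=> [C C0 HC]; apply: (dvdp_exp_bounded (C := C ^+ n.+1)); first exact: expf_neq0.
move=> m; have [b] := HC m; rewrite -rmorphXn => /(congr1 (fun a => \det (mu span_r a))).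
rewrite !(muZ span_r ind_r) !detZ (muX span_r ind_r).
have -> : \det (mu span_r z ^+ m) = \det (mu span_r z) ^+ m.
  by elim: (m) => [|j IH]; rewrite ?det1 // !exprS -IH -det_mulmx.
by move=> ->; rewrite -exprM mulnC exprM dvdp_mulr.
Qed.

(** For every l in k, (l e - z) / e is almost integral, so e^(n+1) divides the characteristic
    polynomial of z at l e. Varying l separates its terms, and the term of degree n contains the
    trace. *)
Lemma almost_int_trace e z : e != 0 -> almost_int e z -> e %| \tr (mu span_r z).
Proof.
move=> e0 Hz; set A := mu span_r z.
have main i : e ^+ n.+1 %| e ^+ i * (char_poly A)`_i.
  have [lt|ge] := ltnP n i.
    by apply: dvdp_mulr; rewrite -(subnK lt) exprD dvdp_mull.
  pose v (i : 'I_n.+2) := e ^+ i * (char_poly A)`_i.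
  have -> : e ^+ i * (char_poly A)`_i = v (inord i) by rewrite /v inordK // ltnS leqW.
  apply: (dvdp_family char0) => l.
  have -> : \sum_(i < n.+2) l ^+ i *: v i = (char_poly A).[l%:P * e].
    rewrite horner_coef size_char_poly; apply: eq_bigr => j _.
    by rewrite exprMn -polyC_exp -mul_polyC /v; ring.
  rewrite horner_char_poly.
  have -> : (l%:P * e)%:M - A = mu span_r (h e * h l%:P + -1 * z).
    rewrite (muD span_r ind_r) -rmorphM (mu_const span_r ind_r) mulrC; congr (_ + _).
    by rewrite -(rmorph1 h) -(rmorphN h) (muZ span_r ind_r) scaleN1r.
  apply: almost_int_det; apply: almost_intD; first exact: almost_int_base.
  exact: almost_intM.
have := main n; rewrite exprSr dvdp_mul2l ?expf_neq0 //.
by rewrite -[n]/(n.+1.-1) char_poly_trace // dvdpNr.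
Qed.

(** The traces of z r_j are divisible by e; the adjugate of the trace form recovers from them the
    coordinates of z multiplied by the discriminant. *)
Lemma almost_int_disc e z : e != 0 -> almost_int e z ->
  exists w, h (disc span_r) * z = h e * w.
Proof.
move=> e0 Hz.
have dv j : e %| (co span_r z *m trace_form span_r) 0 j.
  rewrite (trace_form_co span_r ind_r) mulrC; apply: almost_int_trace => //.
  exact: almost_intM.
pose u := \row_j ((co span_r z *m trace_form span_r) 0 j %/ e)%R.
have uE : co span_r z *m trace_form span_r = e *: u.
  by apply/rowP => j; rewrite [RHS]mxE [u 0 j]mxE mulrC divpK.
pose u' := u *m \adj (trace_form span_r).
have u'E : disc span_r *: co span_r z = e *: u'.
  by rewrite /u' scalemxAl -uE -mulmxA mul_mx_adj mul_mx_scalar.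
exists (\sum_i h (u' 0 i) * r i).
rewrite {1}(coE span_r z) !mulr_sumr; apply: eq_bigr => i _.
by move/rowP/(_ i): u'E; rewrite [LHS]mxE [RHS]mxE !mulrA -!rmorphM => ->.
Qed.
End AlmostIntegral.

(** * The integral closure *)

Section IntegralClosure.
Variables (k : fieldType) (R : comAlgType k) (h : {rmorphism {poly k} -> R}) (d : {poly k}).
Hypotheses (tf : forall p y, p != 0 -> h p * y = 0 -> y = 0) (d0 : d != 0).
Hypothesis disc_d : forall e z, e != 0 -> almost_int h e z -> exists w, h d * z = h e * w.
Implicit Types (a b : R).

(** By [disc_d] any almost integral fraction can be rewritten with denominator d, so numerators over
    d describe the whole closure. *)
Definition iclos_pred : {pred R} := fun a => `[< almost_int h d a >].

Lemma iclos_predP a : reflect (almost_int h d a) (a \in iclos_pred).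
Proof. exact: asboolP. Qed.

Lemma iclos_submod : submod_closed iclos_pred.
Proof.
split; first by apply/iclos_predP; rewrite -(mulr0 (h d)); apply: almost_int_base.
move=> l a b /iclos_predP Ha /iclos_predP Hb; apply/iclos_predP; apply: almost_intD => //.
by rewrite -mulr_algl; apply: almost_intM.
Qed.
HB.instance Definition _ := GRing.isSubmodClosed.Build k R iclos_pred iclos_submod.

(* An element a of this type stands for the fraction a / h d, so the product of
   a and b is a b / h d and the unit is h d. The ring structure depends on the
   proofs tf, d0 and disc_d, which the beta-redex records as parameters. *)
Definition iclos := (fun _ _ _ => {a : R | a \in iclos_pred}) tf d0 disc_d.
Definition iclos_val : iclos -> R := sval.
HB.instance Definition _ := [isSub of iclos for iclos_val].
HB.instance Definition _ := [Choice of iclos by <:].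
HB.instance Definition _ := [SubChoice_isSubLmodule of iclos by <:].

Implicit Types (s t u : iclos).

Lemma iclos_int s : almost_int h d (val s).
Proof. exact/iclos_predP/valP. Qed.

(** The product of two numerators is almost integral over d^2; [disc_d] makes it a multiple of h d,
    and the quotient is again a numerator over d. *)
Lemma iclos_mul_subproof s t : exists u : iclos, h d * val u = val s * val t.
Proof.
have st := almost_int_mul (iclos_int s) (iclos_int t).
have [w Hw] := disc_d (mulf_neq0 d0 d0) st.
have {}Hw : h d * w = val s * val t.
  by apply: (cancel_h tf d0); rewrite Hw rmorphM mulrA.
have wS : w \in iclos_pred.
  by apply/iclos_predP; apply: (almost_int_cancel tf d0); rewrite Hw.
by exists (exist _ w wS).
Qed.

Definition iclos_mul s t : iclos := sval (cid (iclos_mul_subproof s t)).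

Lemma iclos_mulE s t : h d * val (iclos_mul s t) = val s * val t.
Proof. exact: svalP (cid (iclos_mul_subproof s t)). Qed.

Lemma iclos_inj s t : h d * val s = h d * val t -> s = t.
Proof. by move/(cancel_h tf d0)/val_inj. Qed.

Definition iota_val a := h d * a.
Lemma iota_subproof a : iota_val a \in iclos_pred.
Proof. exact/iclos_predP/almost_int_base. Qed.
Definition iota a : iclos := exist _ (iota_val a) (iota_subproof a).

Lemma val_iota a : val (iota a) = h d * a. Proof. by []. Qed.

Lemma iclos_mulA : associative iclos_mul.
Proof.
move=> s t u; apply: iclos_inj; rewrite !iclos_mulE; apply: (cancel_h tf d0).
by rewrite mulrCA iclos_mulE [RHS]mulrA iclos_mulE mulrA.
Qed.
Lemma iclos_mulC : commutative iclos_mul.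
Proof. by move=> s t; apply: iclos_inj; rewrite !iclos_mulE mulrC. Qed.
Lemma iclos_mul1 : left_id (iota 1) iclos_mul.
Proof. by move=> s; apply: iclos_inj; rewrite iclos_mulE val_iota mulr1. Qed.
Lemma iclos_mulDl : left_distributive iclos_mul +%R.
Proof.
by move=> s t u; apply: iclos_inj; rewrite iclos_mulE !raddfD /= mulrDr !iclos_mulE mulrDl.
Qed.
Lemma iclos_1neq0 : iota 1 != 0.
Proof.
apply/eqP => /(congr1 val); rewrite val_iota raddf0 => /(tf d0)/eqP.
by rewrite oner_eq0.
Qed.
HB.instance Definition _ := GRing.Zmodule_isComNzRing.Build iclos
  iclos_mulA iclos_mulC iclos_mul1 iclos_mulDl iclos_1neq0.

Lemma iclos_scaleAl (l : k) s t : l *: (s * t) = (l *: s) * t.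
Proof.
by apply: iclos_inj; rewrite iclos_mulE !linearZ /= -scalerAr iclos_mulE scalerAl.
Qed.
HB.instance Definition _ := GRing.Lmodule_isLalgebra.Build k iclos iclos_scaleAl.
HB.instance Definition _ := GRing.Lalgebra_isComAlgebra.Build k iclos.

Lemma iota_zmod : zmod_morphism iota.
Proof. by move=> a b; apply: val_inj; rewrite raddfB /= /iota_val mulrBr. Qed.
Lemma iota_monoid : monoid_morphism iota.
Proof.
split=> // a b; apply: iclos_inj; rewrite iclos_mulE !val_iota; ring.
Qed.
Lemma iota_scalable : scalable iota.
Proof. by move=> l a; apply: val_inj; rewrite linearZ /= /iota_val scalerAr. Qed.
HB.instance Definition _ := GRing.isZmodMorphism.Build R iclos iota iota_zmod.
HB.instance Definition _ := GRing.isMonoidMorphism.Build R iclos iota iota_monoid.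
HB.instance Definition _ := GRing.isScalable.Build k R iclos *:%R iota iota_scalable.
End IntegralClosure.

(* rho s / h d is the element s of the integral closure S, seen in the total
   ring of fractions of R. *)
Record integral_closure (k : fieldType) (R : comAlgType k) (h : {rmorphism {poly k} -> R})
    (d : {poly k}) (S : comAlgType k) (iota : {lrmorphism R -> S}) (rho : S -> R) : Prop :=
  IntegralClosure {
    rhoD : forall s t, rho (s + t) = rho s + rho t;
    rho_inj : injective rho;
    rhoM : forall s t, h d * rho (s * t) = rho s * rho t;
    rho_iota : forall a, rho (iota a) = h d * a;
    rho_int : forall s, almost_int h d (rho s);
    rho_surj : forall a, almost_int h d a -> exists s, rho s = a }.

Lemma integral_closure_exists (k : fieldType) (R : comAlgType k)
    (h : {rmorphism {poly k} -> R}) (d : {poly k}) :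
  (forall p y, p != 0 -> h p * y = 0 -> y = 0) -> d != 0 ->
  (forall e z, e != 0 -> almost_int h e z -> exists w, h d * z = h e * w) ->
  exists (S : comAlgType k) (iota : {lrmorphism R -> S}) (rho : S -> R),
    integral_closure h d iota rho.
Proof.
move=> tf d0 disc_d.
exists (iclos tf d0 disc_d : comAlgType k), (@iota k R h d tf d0 disc_d : {lrmorphism _ -> _}), val.
split.
- by move=> s t; rewrite raddfD.
- exact: val_inj.
- exact: iclos_mulE.
- by [].
- exact: iclos_int.
by move=> a Ha; exists (exist _ a (introT (iclos_predP _ _ _) Ha)).
Qed.

(** * Invertibility of the radical of a multiple *)

Section Radical.
Variables (k : fieldType) (S : comAlgType k).
Implicit Types (U I : S -> Prop) (a b s t x y z : S).

(** Induction on generators. Products of N' elements fall into U + (w); in a product of m N'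
    elements, each block of N' contributes a factor w modulo U, and a power of w lies in U. *)
Lemma nil_ideal_power vs U : is_ideal U ->
  (forall w, w \in vs -> exists n, U (w ^+ n)) ->
  exists N, forall xs, size xs = N -> (forall x, x \in xs -> inspan U vs x) ->
    U (\prod_(x <- xs) x).
Proof.
elim: vs U => [|w vs IH] U idU nil.
  exists 1%N => -[|x [|]] //= _ H; rewrite big_seq1; apply: H; exact: mem_head.
have [U0 [UD UM]] := idU.
pose U' z := exists u s, U u /\ z = u + s * w.
have idU' : is_ideal U' by exact: is_ideal_adjoin.
have UU' z : U z -> U' z by exists z, 0; split=> //; rewrite mul0r addr0.
have [|N' HN'] := IH U' idU'.
  move=> v vs_v; have [|n Un] := nil v; first by rewrite inE vs_v orbT.
  by exists n; apply: UU'.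
have [|n Un] := nil w; first exact: mem_head.
have mono' z : inspan U (w :: vs) z -> inspan U' vs z.
  move=> /= [c /(inspan_mono UU') H]; rewrite -(subrK (c *: w) z).
  have [_ SD _] := inspan_submod vs (is_ideal_submod idU').
  apply: SD => //; apply: inspan_base; first exact: is_ideal_submod.
  by exists 0, c%:A; split=> //; rewrite add0r mulr_algl.
suff H m xs : size xs = (m * N')%N -> (forall x, x \in xs -> inspan U (w :: vs) x) ->
    exists s, U (\prod_(x <- xs) x - w ^+ m * s).
  exists (n * N')%N => xs sz Hxs; have [s Hs] := H n xs sz Hxs.
  rewrite -(subrK (w ^+ n * s) (\prod_(x <- xs) x)); apply: (UD) => //.
  by rewrite mulrC; apply: (UM).
elim: m xs => [|m IHm] xs sz Hxs.
  by exists (\prod_(x <- xs) x); rewrite mul1r subrr.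
have [||s2 Hs2] := IHm (drop N' xs).
- by rewrite size_drop sz mulSn addKn.
- by move=> x /mem_drop; apply: Hxs.
have [||u [s1 [Uu E]]] := HN' (take N' xs).
- by rewrite size_takel // sz mulSn leq_addr.
- by move=> x /mem_take/Hxs; apply: mono'.
exists (s1 * s2); rewrite -{1}(cat_take_drop N' xs) big_cat /= E.
set P := \prod_(x <- drop _ _) x in Hs2 *.
have -> : (u + s1 * w) * P - w ^+ m.+1 * (s1 * s2) =
  P * u + (s1 * w) * (P - w ^+ m * s2) by rewrite exprS; ring.
by apply: (UD); apply: (UM).
Qed.

Variables (c : S) (vs : seq S).
Hypothesis fin_c : forall a, inspan (multiples c) vs a.

Definition crad a := exists n, multiples c (a ^+ n).

Lemma rad_ideal : is_ideal crad.
Proof.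
have [U0 [UD UM]] := multiples_ideal c.
split; first by exists 1%N; rewrite expr1.
split=> [a b [n Ha] [m Hb]|a b [n Hb]]; last first.
  by exists n; rewrite exprMn; apply: (UM).
exists (n + m)%N; rewrite exprDn; elim/big_ind: _ => // i _.
rewrite -mulr_natl; apply: (UM).
have [le|lt] := leqP m i.
  by rewrite -(subnK le) exprD mulrA; apply: (UM).
have le : (n <= n + m - i)%N by rewrite -addnBA ?leq_addr // ltnW.
by rewrite -(subnK le) exprD mulrAC; apply: (UM).
Qed.

Lemma rad_multiples a : multiples c a -> crad a.
Proof. by exists 1%N; rewrite expr1. Qed.

Lemma rad_power : exists N, forall xs, size xs = N -> (forall x, x \in xs -> crad x) ->
  multiples c (\prod_(x <- xs) x).
Proof.
have idc := multiples_ideal c.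
have [ws [Wws Hws]] := inspan_sub (is_ideal_submod idc) (is_ideal_submod rad_ideal)
  (fun a _ => fin_c a).
have [N HN] := nil_ideal_power idc Wws.
by exists N => xs sz Hxs; apply: HN => // x /Hxs; apply: Hws.
Qed.

(** S/J is von Neumann regular: by Fitting's relation a^m (1 - a q) lies in c S, so a (1 - a q) is
    nilpotent modulo c. *)
Lemma rad_regular a : exists b, crad (a - a * a * b).
Proof.
have [m [q [w E]]] := inspan_fitting a (multiples_ideal c) fin_c.
exists q, m.+1; exists (w * a * (1 - a * q) ^+ m).
have -> : a - a * a * q = a * (1 - a * q) by ring.
rewrite exprMn !exprS.
have -> : a * a ^+ m * ((1 - a * q) * (1 - a * q) ^+ m) =
  (a ^+ m - a ^+ m.+1 * q) * (a * (1 - a * q) ^+ m) by rewrite exprS; ring.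
by rewrite E; ring.
Qed.

(* The two properties of an integrally closed S that are used: c is regular,
   and the multiplier ring of an ideal containing c is S. *)
Hypothesis cancel_c : forall a b, c * a = c * b -> a = b.
Hypothesis closed_c : forall J a, is_ideal J -> J c ->
  (forall j, J j -> exists2 j', J j' & a * j = c * j') -> multiples c a.

(** Numerators over c of the inverse fractional ideal of J. *)
Definition colon a := forall j, crad j -> multiples c (a * j).

Definition pairs_ok (ps : seq (S * S)) := forall p, p \in ps -> colon p.1 /\ crad p.2.

(** The ideal T = J^-1 J contains J. As S/J is regular, some f with 1 - f in T satisfies f T in J;
    then f J^-1 multiplies J into itself and lies in S by [closed_c]. Starting from J^N in c S,
    powers of f strip off the factors of J one at a time until f^j lies in c S. So f is in J, hence
    in T, and T contains 1. *)
Lemma rad_invertible : exists2 ps, pairs_ok ps & c = \sum_(p <- ps) p.1 * p.2.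
Proof.
have [J0 [JD JM]] := rad_ideal; have [c0 [cD cM]] := multiples_ideal c.
pose T x := exists2 ps, pairs_ok ps & c * x = \sum_(p <- ps) p.1 * p.2.
have idT : is_ideal T.
  split; first by exists [::] => //; rewrite big_nil mulr0.
  split=> [x y [ps Hps Ex] [qs Hqs Ey]|a x [ps Hps Ex]].
    exists (ps ++ qs); last by rewrite mulrDr Ex Ey big_cat.
    by move=> p; rewrite mem_cat => /orP[/Hps|/Hqs].
  exists [seq (p.1, a * p.2) | p <- ps].
    by move=> _ /mapP[p /Hps[? ?] ->]; split=> //=; apply: (JM).
  rewrite mulrCA Ex big_map mulr_sumr; apply: eq_bigr => p _ /=; ring.
have colon_T l j x : colon l -> crad j -> l * j = c * x -> T x.
  move=> Hl Hj E; exists [:: (l, j)]; last by rewrite big_seq1 E.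
  by move=> p; rewrite inE => /eqP ->.
have JT x : crad x -> T x.
  by move=> Hx; apply: (colon_T c x) => // j _; exists j.
have [T0 [TD TM]] := idT.
have [ws [Wws Hws]] := inspan_sub (is_ideal_submod (multiples_ideal c))
  (is_ideal_submod idT) (fun a _ => fin_c a).
have [e Te He] : exists2 e, T e & forall w, w \in ws -> crad ((1 - e) * w).
  elim: ws Wws {Hws} => [|w ws IH] Wws; first by exists 0.
  have [|e' Te' He'] := IH; first by move=> x xs; apply: Wws; rewrite inE xs orbT.
  pose a := (1 - e') * w; have [b Hb] := rad_regular a.
  exists (e' + (b * (1 - e') * (1 - e')) * w).
    by apply: (TD) => //; apply: (TM); apply: Wws; apply: mem_head.
  have E z : (1 - (e' + b * (1 - e') * (1 - e') * w)) * z =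
    (1 - a * b) * ((1 - e') * z) by rewrite /a; ring.
  move=> z; rewrite inE E => /orP[/eqP ->|/He' H]; last exact: JM.
  by rewrite -/a; have -> : (1 - a * b) * a = a - a * a * b by ring.
pose f := 1 - e.
have fT x : T x -> crad (f * x).
  move/Hws; elim: ws He x {Wws Hws} => [|w ws IH] He x /=.
    by move=> [z ->]; apply: rad_multiples; exists (f * z); ring.
  case=> l /IH H; rewrite -(subrK (l *: w) x) mulrDr; apply: (JD).
    by apply: H => v vs'; apply: He; rewrite inE vs' orbT.
  by rewrite -scalerAr -mulr_algl; apply/JM/He/mem_head.
have fL l : colon l -> multiples c (f * l).
  move=> Hl; apply: (closed_c rad_ideal); first by apply: rad_multiples; exists 1; rewrite mulr1.
  move=> j Hj; have [x Ex] := Hl j Hj; exists (f * x).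
    exact/fT/(colon_T l j).
  by rewrite -mulrA Ex mulrCA.
have [N HN] := rad_power.
have step i : exists j, forall xs, (size xs + i)%N = N -> (forall x, x \in xs -> crad x) ->
    multiples c (f ^+ j * \prod_(x <- xs) x).
  elim: i => [|i [j IH]].
    by exists 0%N => xs; rewrite addn0 mul1r; apply: HN.
  exists j.+1 => xs sz Hxs; rewrite exprS -mulrA; apply: fL => y Hy.
  rewrite -mulrA [_ * y]mulrC.
  have -> : y * \prod_(x <- xs) x = \prod_(x <- y :: xs) x by rewrite big_cons.
  apply: IH.
    by rewrite /= addSnnS.
  by move=> x; rewrite inE => /orP[/eqP ->|/Hxs].
have [j /(_ [::] (add0n _))] := step N.
rewrite big_nil mulr1 => Hf.
have Tf : T f by apply: JT; exists j; apply: Hf.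
have [ps Hps E] := TD _ _ Te Tf.
by exists ps => //; rewrite -E /f; ring.
Qed.

(** * A generator of the radical modulo its square *)

Definition rad2 z := exists2 ps : seq (S * S),
  (forall p, p \in ps -> crad p.1 /\ crad p.2) & z = \sum_(p <- ps) p.1 * p.2.

Lemma rad2_ideal : is_ideal rad2.
Proof.
have [J0 [JD JM]] := rad_ideal.
split; first by exists [::] => //; rewrite big_nil.
split=> [x y [ps Hps ->] [qs Hqs ->]|a x [ps Hps ->]].
  exists (ps ++ qs); last by rewrite big_cat.
  by move=> p; rewrite mem_cat => /orP[/Hps|/Hqs].
exists [seq (a * p.1, p.2) | p <- ps].
  by move=> _ /mapP[p /Hps[? ?] ->]; split=> //=; apply: (JM).
by rewrite big_map mulr_sumr; apply: eq_bigr => p _; rewrite mulrA.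
Qed.

Lemma rad2M x y : crad x -> crad y -> rad2 (x * y).
Proof.
move=> Hx Hy; exists [:: (x, y)]; last by rewrite big_seq1.
by move=> p; rewrite inE => /eqP ->.
Qed.

(** J/J^2 is invertible over the regular ring S/J. With c = sum l_p j_p, the elements A_p = l_p j_p
    / c have sum 1, and where A_p is invertible j_p generates J, because A_p y = (l_p y / c) j_p.
    These local generators are glued along idempotents of S/J. *)
Lemma rad_principal_mod_square : exists2 t, crad t &
  forall y, crad y -> exists s, rad2 (y - s * t).
Proof.
have [ps ps_ok cE] := rad_invertible.
have [J0 [JD JM]] := rad_ideal; have [Q0 [QD QM]] := rad2_ideal.
have [A HA] : exists A : S * S -> S, forall p, p \in ps -> p.1 * p.2 = c * A p.
  have ex p : exists a, p \in ps -> p.1 * p.2 = c * a.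
    have [/ps_ok[Hl Hj]|_] := boolP (p \in ps); last by exists 0.
    by have [w Hw] := Hl _ Hj; exists w.
  by have [A HA] := choice ex; exists A.
have A1 : \sum_(p <- ps) A p = 1.
  apply: cancel_c; rewrite mulr1 {2}cE mulr_sumr big_seq [RHS]big_seq.
  by apply: eq_bigr => p /HA.
(* Modulo J, [g] is the idempotent on which every A_p treated so far vanishes; t generates J modulo
   J^2 on the complement of g, and g t is in J^2. The next pair (l, j) contributes e j on the piece
   e = g a b, where its A is invertible. *)
have [t [g [Jt H1 H2 _]]] : exists t g, [/\ crad t,
    forall y, crad y -> exists s, rad2 (y - g * y - s * t),
    forall p, p \in ps -> crad (g * A p) & crad (g * g - g) /\ rad2 (g * t)].
  elim: ps ps_ok HA {cE A1} => [|[l j] ps IH] ps_ok HA.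
    exists 0, 1; split=> //; last by rewrite !mulr1 subrr mulr0.
    by move=> y _; exists 0; rewrite mul1r mul0r !subrr.
  have [||t [g [Jt H1 H2 [H3 H4]]]] := IH.
  - by move=> p pps; apply: ps_ok; rewrite inE pps orbT.
  - by move=> p pps; apply: HA; rewrite inE pps orbT.
  have [/= Hl Hj] := ps_ok _ (mem_head _ _).
  set a := A (l, j); have /= Ha := HA _ (mem_head _ _); rewrite -/a in Ha.
  have [b Hb] := rad_regular a; set e := g * a * b.
  have ee : crad (e * e - e).
    have -> : e * e - e = (a * a * b * b) * (g * g - g) + (- (g * b)) * (a - a * a * b).
      by rewrite /e; ring.
    by apply: (JD); apply: (JM).
  exists (t + e * j), (g - e); split.
  - by apply: (JD) => //; apply: (JM).
  - move=> y Hy; have [s Hs] := H1 y Hy; have [phi Hphi] := Hl _ Hy.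
    have ay : a * y = phi * j.
      by apply: cancel_c; rewrite mulrA -Ha mulrA -Hphi; ring.
    exists (s * (1 - e) + g * b * phi).
    have -> : y - (g - e) * y - (s * (1 - e) + g * b * phi) * (t + e * j) =
      (y - g * y - s * t) + (s * a * b - b * phi) * (g * t) + s * ((e * e - e) * j)
      + (g * b * (a * y) * 1 - g * b * (phi * j) * e).
      by rewrite /e; ring.
    rewrite -ay; have -> : g * b * (a * y) * 1 - g * b * (a * y) * e = (-1) * ((e * e - e) * y).
      by rewrite /e; ring.
    by apply: (QD); [apply: (QD); [apply: (QD) => //|]|]; apply: (QM) => //; apply: rad2M.
  - move=> p; rewrite inE => /orP[/eqP ->|/H2 H]; last first.
      have -> : (g - e) * A p = (1 - a * b) * (g * A p) by rewrite /e; ring.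
      exact: JM.
    have -> : (g - e) * A (l, j) = g * (a - a * a * b) by rewrite -/a /e; ring.
    exact: JM.
  split.
    have -> : (g - e) * (g - e) - (g - e) = ((1 - a * b) * (1 - a * b)) * (g * g - g)
       + (- (g * b)) * (a - a * a * b) by rewrite /e; ring.
    by apply: (JD); apply: (JM).
  have -> : (g - e) * (t + e * j) = (1 - a * b) * (g * t) + (g * g * b) * ((a - a * a * b) * j).
    by rewrite /e; ring.
  by apply: (QD); apply: (QM) => //; apply: rad2M.
exists t => // y Hy; have [s Hs] := H1 y Hy; exists s.
have Jg : crad g.
  rewrite -[g]mulr1 -A1 mulr_sumr big_seq; elim/big_ind: _ => // p; exact: H2.
have -> : y - s * t = (y - g * y - s * t) + g * y by ring.
by apply: (QD) => //; apply: rad2M.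
Qed.

(** * Powers of the radical and the uniformizer *)

Fixpoint idpow (m : nat) z : Prop := if m is m'.+1 then
  exists2 ps : seq (S * S), (forall p, p \in ps -> crad p.1 /\ idpow m' p.2) &
    z = \sum_(p <- ps) p.1 * p.2
  else True.

Lemma idpow_ideal m : is_ideal (idpow m).
Proof.
have [J0 [JD JM]] := rad_ideal.
elim: m => [|m [I0 [ID IM]]] //=.
split; first by exists [::] => //; rewrite big_nil.
split=> [x y [ps Hps ->] [qs Hqs ->]|a x [ps Hps ->]].
  exists (ps ++ qs); last by rewrite big_cat.
  by move=> p; rewrite mem_cat => /orP[/Hps|/Hqs].
exists [seq (a * p.1, p.2) | p <- ps].
  by move=> _ /mapP[p /Hps[? ?] ->]; split=> //=; apply: (JM).
by rewrite big_map mulr_sumr; apply: eq_bigr => p _; rewrite mulrA.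
Qed.

Lemma idpowS m x y : crad x -> idpow m y -> idpow m.+1 (x * y).
Proof.
move=> Hx Hy; exists [:: (x, y)]; last by rewrite big_seq1.
by move=> p; rewrite inE => /eqP ->.
Qed.

Lemma idpow_multiples e M z :
  (forall xs, size xs = M -> (forall x, x \in xs -> crad x) ->
     multiples e (\prod_(x <- xs) x)) ->
  idpow M z -> multiples e z.
Proof.
move=> HM Hz; have [e0 [eD eM]] := multiples_ideal e.
suff H m xs y : (size xs + m = M)%N -> (forall x, x \in xs -> crad x) -> idpow m y ->
    multiples e (\prod_(x <- xs) x * y).
  by have := H M [::] z (add0n _); rewrite big_nil mul1r; apply.
elim: m xs y => [|m IH] xs y sz Hxs /=.
  by move=> _; rewrite mulrC; apply/eM/HM => //; rewrite -sz addn0.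
move=> [ps Hps ->]; rewrite mulr_sumr big_seq; elim/big_ind: _ => // p /Hps[H1 H2].
rewrite mulrA [_ * p.1]mulrC.
have -> : p.1 * \prod_(x <- xs) x = \prod_(x <- p.1 :: xs) x by rewrite big_cons.
apply: IH => //.
  by rewrite /= addSnnS.
by move=> x; rewrite inE => /orP[/eqP ->|/Hxs].
Qed.

(** Substituting the generation modulo J^2 into itself gives y = s t modulo every J^(m+1), and a
    high power of J lies in c^M S. *)
Lemma rad_uniformizer : exists2 t, crad t &
  forall y M, crad y -> exists s w, y = s * t + c ^+ M * w.
Proof.
have [t Jt Ht] := rad_principal_mod_square; exists t => // y M Hy.
have [J0 [JD JM]] := rad_ideal; have [N HN] := rad_power.
have blocks j xs : size xs = (N * j).+1 -> (forall x, x \in xs -> crad x) ->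
    multiples (c ^+ j) (\prod_(x <- xs) x).
  elim: j xs => [|j IH] xs sz Hxs; first by exists (\prod_(x <- xs) x); rewrite mul1r.
  have [||w1 E1] := HN (take N xs).
  - by rewrite size_takel // sz mulnS -addnS leq_addr.
  - by move=> x /mem_take/Hxs.
  have [||w2 E2] := IH (drop N xs).
  - by rewrite size_drop sz mulnS -addnS addKn.
  - by move=> x /mem_drop/Hxs.
  by exists (w1 * w2); rewrite -(cat_take_drop N xs) big_cat /= E1 E2 exprS; ring.
have approx m : exists s, idpow m.+1 (y - s * t).
  elim: m => [|m [s [ps Hps E]]].
    by exists 0; rewrite mul0r subr0 -[y]mulr1; apply: idpowS.
  have [r [Hr]] : exists r, idpow m.+2 (\sum_(p <- ps) p.1 * p.2 - r * t).
    elim: ps Hps {E} => [|p ps IH] Hps.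
      by exists 0; rewrite big_nil mul0r subr0; case: (idpow_ideal m.+2).
    have [|r Hr] := IH; first by move=> q qps; apply: Hps; rewrite inE qps orbT.
    have [H1 H2] := Hps _ (mem_head _ _); have [s1 [qs Hqs E1]] := Ht _ H1.
    exists (s1 * p.2 + r); rewrite big_cons.
    have -> : p.1 * p.2 + \sum_(q <- ps) q.1 * q.2 - (s1 * p.2 + r) * t =
      (p.1 - s1 * t) * p.2 + (\sum_(q <- ps) q.1 * q.2 - r * t) by ring.
    have [I0 [ID IM]] := idpow_ideal m.+2; apply: (ID) => //.
    rewrite E1 mulr_suml big_seq; elim/big_ind: _ => // q /Hqs[q1 q2].
    by rewrite -mulrA; do 2![apply: idpowS => //].
  by move=> Hr'; exists (s + r); rewrite mulrDl opprD addrA E; exists Hr.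
have [s Hs] := approx (N * M)%N.
have [w E] := idpow_multiples (@blocks M) Hs.
by exists s, w; rewrite -E addrC subrK.
Qed.
End Radical.

(** * Comparison of R with its integral closure *)

Section ClosureTheory.
Variables (k : fieldType) (R S : comAlgType k) (h : {rmorphism {poly k} -> R}).
Variables (d : {poly k}) (iota : {lrmorphism R -> S}) (rho : S -> R).
Hypotheses (clS : integral_closure h d iota rho) (d0 : d != 0).
Hypothesis tf : forall p y, p != 0 -> h p * y = 0 -> y = 0.
Implicit Types (a b : R) (s t : S) (p q : {poly k}).

Lemma rho_iotaM a s : rho (iota a * s) = a * rho s.
Proof.
by apply: (cancel_h tf d0); rewrite (rhoM clS) (rho_iota clS); ring.
Qed.

Lemma rho0 : rho 0 = 0.
Proof. by rewrite -[0 in LHS](rmorph0 iota) (rho_iota clS) mulr0. Qed.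

Lemma rhoZ (l : k) s : rho (l *: s) = l *: rho s.
Proof.
rewrite -(mulr_algl l s) -(mulr_algl l (rho s)) -rho_iotaM.
by rewrite linearZ /= rmorph1.
Qed.

Lemma rho_sub s t : rho (s - t) = rho s - rho t.
Proof. by rewrite (rhoD clS) -scaleN1r rhoZ scaleN1r. Qed.

Lemma iota_rho s : iota (rho s) = iota (h d) * s.
Proof. by apply: (rho_inj clS); rewrite (rho_iota clS) rho_iotaM. Qed.

Lemma iota_inj : injective iota.
Proof.
by move=> a b /(congr1 rho); rewrite !(rho_iota clS) => /(cancel_h tf d0).
Qed.

Lemma closure_cancel q s t : q != 0 -> iota (h q) * s = iota (h q) * t -> s = t.
Proof.
move=> q0 /(congr1 rho); rewrite !rho_iotaM => /(cancel_h tf q0).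
exact: rho_inj clS _ _.
Qed.

(** [rho] embeds S in R, and q d R lies in q rho(S), so R is finite modulo q rho(S); [inspan_sub]
    picks spanning elements inside rho(S). *)
Lemma closure_finite :
  (forall p, p != 0 -> exists vs, forall a : R, inspan (multiples (h p)) vs a) ->
  forall q, q != 0 -> exists vs, forall s, inspan (multiples (iota (h q))) vs s.
Proof.
move=> fin q q0; have [vs Hvs] := fin (q * d) (mulf_neq0 q0 d0).
pose U a := exists s, a = h q * rho s.
pose W a := exists s, a = rho s.
have sU : is_submod U.
  split; first by exists 0; rewrite rho0 mulr0.
    by move=> _ _ [s ->] [t ->]; exists (s + t); rewrite (rhoD clS) mulrDr.
  by move=> l _ [s ->]; exists (l *: s); rewrite rhoZ scalerAr.
have sW : is_submod W.
  split; first by exists 0; rewrite rho0.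
    by move=> _ _ [s ->] [t ->]; exists (s + t); rewrite (rhoD clS).
  by move=> l _ [s ->]; exists (l *: s); rewrite rhoZ.
have HU a : inspan U vs a.
  apply: inspan_mono (Hvs a) => _ [w ->].
  by exists (iota w); rewrite (rho_iota clS) rmorphM mulrA.
have [ws [Wws Hws]] := inspan_sub sU sW (fun a _ => HU a).
have [ws' wsE] : exists ws', ws = map rho ws'.
  elim: ws Wws {Hws} => [|w ws IH] Wws; first by exists [::].
  have [s ws_s] := Wws _ (mem_head _ _).
  have [|ws' ->] := IH; first by move=> x xs; apply: Wws; rewrite inE xs orbT.
  by exists (s :: ws'); rewrite ws_s.
rewrite {}wsE {Wws} in Hws.
exists ws' => s; have : inspan U (map rho ws') (rho s) by apply: Hws; exists s.
elim: ws' s {Hws} => [|w ws' IH] s /=.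
  by move=> [t E]; exists t; apply: (rho_inj clS); rewrite rho_iotaM.
by move=> [l]; rewrite -rhoZ -rho_sub => /IH; exists l.
Qed.

Lemma rhoX s t m : h d ^+ m * rho (s ^+ m * t) = rho s ^+ m * rho t.
Proof.
elim: m => [|m IH]; first by rewrite !mul1r.
by rewrite [s ^+ _]exprS -mulrA exprSr -mulrA (rhoM clS) mulrCA IH [rho s ^+ m.+1]exprS mulrA.
Qed.

Hypothesis disc_d : forall e z, e != 0 -> almost_int h e z -> exists w, h d * z = h e * w.

(** From s J in q J follows s^m q in q^m S for all m, so s / q has powers with bounded denominators
    and belongs to the closure. *)
Lemma closure_multiplier q (J : S -> Prop) s : q != 0 -> is_ideal J -> J (iota (h q)) ->
  (forall j, J j -> exists2 j', J j' & s * j = iota (h q) * j') ->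
  multiples (iota (h q)) s.
Proof.
move=> q0 idJ Jc HJ; set c := iota (h q) in Jc HJ *.
have pow m : exists2 j, J j & s ^+ m * c = c ^+ m * j.
  elim: m => [|m [j Jj E]]; first by exists c; rewrite // !mul1r.
  have [j' Jj' E'] := HJ j Jj; exists j' => //.
  by rewrite exprS -mulrA E mulrCA E' exprSr mulrA.
have qd0 : d * q != 0 by rewrite mulf_neq0.
have ai : almost_int h (d * q) (rho s).
  exists (q * d) => [|m]; first by rewrite mulf_neq0.
  have [j _ E] := pow m; exists (rho j).
  have -> : h (q * d) * rho s ^+ m = rho s ^+ m * rho (iota (h q)).
    by rewrite (rho_iota clS) rmorphM; ring.
  by rewrite -rhoX -/c E /c -(rmorphXn iota) rho_iotaM rmorphM exprMn mulrA.
have [w Hw] := disc_d qd0 ai.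
have {}Hw : rho s = h q * w.
  by apply: (cancel_h tf d0); rewrite Hw rmorphM mulrA.
have [t tw] : exists t, rho t = w.
  by apply: (rho_surj clS); apply: (almost_int_cancel tf q0); rewrite -Hw.
by exists t; apply: (rho_inj clS); rewrite rho_iotaM tw.
Qed.

(** A map back from Omega_S to Omega_R composes with Omega_R -> Omega_S to multiplication by D^4,
    and D = h d is a nonzerodivisor. *)
Lemma omega_closure_inj :
  (forall (w : seq (R * R)) (r : R), nonzerodivisor r -> kd_null (dscale r w) -> kd_null w) ->
  forall w : seq (R * R), kd_null (dmap iota w) -> kd_null w.
Proof.
move=> notor s Hs; set D := h d.
have nzd m : nonzerodivisor (D ^+ m).
  move=> y; rewrite /D -rmorphXn; apply: tf; exact: expf_neq0.
apply: (notor _ (D ^+ 4)); first exact: nzd.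
apply/osum0; rewrite osum_scale.
(* By the quotient rule for b = rho(b) / D, the second factor stands for D^2 db. The leading D
   absorbs the denominator in rho(a b) = rho(a) rho(b) / D. *)
pose phi (a b : S) : omega R := (D * rho a) *: (D *: dif (rho b) - rho b *: dif D).
have <- : \sum_(p <- dmap iota s) phi p.1 p.2 = D ^+ 4 *: osum s.
  rewrite big_map /osum scaler_sumr; apply: eq_bigr => p _.
  rewrite /phi !(rho_iota clS) -/D difM [D *: (_ + _)]scalerDr !scalerA addrK !scalerA.
  by congr (_ *: _); ring.
apply: kd_sum0 Hs.
- by move=> a a' b; rewrite /phi (rhoD clS) mulrDr scalerDl.
- move=> a b c; rewrite /phi (rhoD clS) difD -[RHS]scalerDr; congr (_ *: _).
  by rewrite scalerDr scalerDl opprD addrACA.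
- move=> a b c; rewrite /phi !(rhoM clS).
  have -> : (D * rho a) *: (D *: dif (rho (b * c)) - rho (b * c) *: dif D) =
     rho a *: (D *: (D *: dif (rho (b * c)) + rho (b * c) *: dif D) -
       (D * rho (b * c)) *: dif D - (D * rho (b * c)) *: dif D).
    rewrite [D *: (_ + _)]scalerDr !scalerA addrK [LHS]scalerBr [RHS]scalerBr !scalerA.
    by congr (_ *: _ - _ *: _); ring.
  rewrite -difM (rhoM clS) difM -!scalerA; set B := rho b; set C := rho c.
  rewrite -scalerDr; congr (_ *: _); rewrite !(scalerBr, scalerDr) !scalerA.
  rewrite [D * B]mulrC [D * C]mulrC [C * B]mulrC.
  by rewrite -[LHS]addrA addrACA.
move=> a l; rewrite /phi.
have -> : rho l%:A = l%:A * D.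
  have -> : l%:A = iota l%:A * 1 by rewrite linearZ /= rmorph1 mulr1.
  rewrite rho_iotaM; congr (_ * _).
  by rewrite -[RHS]mulr1 -(rho_iota clS) rmorph1.
by rewrite difM dif_const scaler0 addr0 [D *: _]scalerA [D * l%:A]mulrC subrr scaler0.
Qed.
End ClosureTheory.

(** * Regularity at a maximal ideal *)

Section Regularity.
Variables (k : fieldType) (R : comAlgType k) (M : R -> Prop).
Hypotheses (dimR : pure_dim_one R) (maxM : maximal_ideal M).

Lemma maximal_prime : prime_ideal M.
Proof.
have [idM [M1 max]] := maxM; have [M0 [MD MM]] := idM.
split=> //; split=> // x y Mxy; apply: contrapT => /not_orP[nx ny].
have [H|H] := max _ (is_ideal_adjoin x idM) (fun z Mz =>
  ex_intro _ z (ex_intro _ 0 (conj Mz (esym (etrans (congr1 (+%R z) (mul0r x)) (addr0 z)))))).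
  by apply: nx; apply/H; exists 0, 1; rewrite mul1r add0r.
have [m [r [Mm E]]] := H 1; apply: ny.
have -> : y = y * m + r * (x * y) by rewrite -{1}[y]mulr1 E; ring.
by apply: MD; apply: (MM).
Qed.

Lemma minimal_prime_below_max : exists2 P, minimal_prime P & strict_sub P M.
Proof.
have [P mP PM] := minimal_prime_below maximal_prime; exists P => //; split=> //.
apply: contrapT => N.
have MP x : M x -> P x by move=> Mx; apply: contrapT => nPx; apply: N; exists x.
have [[Q [[idQ [Q1 _]] [PQ [q [Qq nPq]]]]] _] := dimR mP.
have [_ [_ max]] := maxM.
have [|H|H] := max Q idQ; first by move=> x /MP/PQ.
  by apply/nPq/MP/H.
exact/Q1/H.
Qed.

(** For q in M outside a minimal prime P below M, the relation (q G + h c) q^l = 0 puts the first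
    factor in P, hence h c in M. *)
Lemma maximal_poly (h : {rmorphism {poly k} -> R}) : (forall r, integralOver h r) ->
  exists2 p, p != 0 & M (h p).
Proof.
move=> int; have [P [[idP [_ PP]] _] [PM [q [Mq nPq]]]] := minimal_prime_below_max.
have [G [c [l [c0 E]]]] := integral_trailing (int q).
exists c => //; have [[M0 [MD MM]] _] := maxM.
have nPX j : ~ P (q ^+ j).
  elim: j => [|j IH]; last by rewrite exprS => /PP[].
  by rewrite expr0 => /PM; case: maxM => _ [].
have /PP[/PM H|/nPX //] : P ((q * G + h c) * q ^+ l) by rewrite E; case: idP.
have -> : h c = (q * G + h c) + (- G) * q by ring.
by apply: MD => //; apply: MM.
Qed.

Hypothesis finM : exists p (vs : seq R), M p /\ forall a, inspan (multiples p) vs a.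

(* Nakayama: if M = M^2 with M finitely generated, then some 1 - e with e in M
   kills M, so that M is contained in every prime inside M. *)
Lemma maximal_not_idempotent :
  ~ forall y, M y -> exists2 s : seq (R * R), (forall q, q \in s -> M q.1 /\ M q.2) &
     y = \sum_(q <- s) q.1 * q.2.
Proof.
move=> M2; have [idM [M1 _]] := maxM; have [M0 [MD MM]] := idM.
have [p [vs [Mp Hvs]]] := finM.
have [ws [Mws Hws]] := inspan_sub (is_ideal_submod (multiples_ideal p))
  (is_ideal_submod idM) (fun a _ => Hvs a).
pose gs := p :: ws.
have Mgs g : g \in gs -> M g by rewrite inE => /orP[/eqP ->|/Mws].
pose id_R : {rmorphism R -> R} := idfun.
have gen y : M y -> modspan id_R gs y.
  move/Hws => H; have : modspan id_R (rev gs) y -> modspan id_R gs y.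
    move=> Hy; apply: (@modspan_ind _ _ id_R (rev gs) (modspan id_R gs) id) Hy => //.
    - exact: modspan0.
    - exact: modspanD.
    - exact: modspanZ.
    by move=> r; rewrite mem_rev; apply: modspan_mem.
  move=> _; rewrite /gs /=.
  have {H} [w Hw] : exists w, modspan id_R ws (y - w * p).
    elim: (ws) y H => [|v ws' IH] y /=.
      by move=> [w ->]; exists w; rewrite mulrC subrr.
    move=> [l /IH[w Hw]]; exists w, l%:A.
    by rewrite /= mulr_algl addrAC.
  by exists w.
pose n := size gs.
have row_M (i : 'I_n) : exists m : 'I_n -> R, (forall j, M (m j)) /\
    gs`_i = \sum_j m j * gs`_j.
  have [s Hs ->] := M2 _ (Mgs _ (mem_nth 0 (ltn_ord i))).
  elim: s Hs => [|q s IH] Hs.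
    exists (fun=> 0); split=> //; rewrite big_nil big1 // => j _; exact: mul0r.
  have [|m [Mm E]] := IH; first by move=> q' q's; apply: Hs; rewrite inE q's orbT.
  have [H1 H2] := Hs _ (mem_head _ _); have [a Ea] := modspanP (gen _ H2).
  exists (fun j => a j * q.1 + m j); split=> [j|]; first by apply: MD => //; apply: MM.
  rewrite big_cons E Ea mulr_sumr -big_split; apply: eq_bigr => j _ /=.
  by rewrite mulrDl mulrA [q.1 * _]mulrC.
have [m Hm] := choice row_M.
pose Z := 1%:M - \matrix_(i < n, j < n) m i j.
have [Q [pi [_ piK]]] := quotient_alg idM M1.
have Z1 : M (1 - \det Z).
  apply/piK; rewrite rmorphB rmorph1 -det_map_mx map_mxB map_mx1.
  have -> : map_mx pi (\matrix_(i < n, j < n) m i j) = 0.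
    by apply/matrixP => i j; rewrite !mxE; apply/piK; apply: (Hm i).1.
  by rewrite subr0 det1 subrr.
have ann (j : 'I_n) : \det Z * gs`_j = 0.
  have Zg : Z *m (\col_(j < n) gs`_j) = 0.
    rewrite mulmxBl mul1mx; apply/colP => i; rewrite !mxE.
    apply/eqP; rewrite subr_eq0 {1}(Hm i).2; apply/eqP.
    by apply: eq_bigr => l _; rewrite !mxE.
  have /colP/(_ j) : (\det Z)%:M *m (\col_(j < n) gs`_j) = 0.
    by rewrite -mul_adj_mx -mulmxA Zg mulmx0.
  by rewrite mul_scalar_mx !mxE.
have [P [[idP [_ PP]] _] [PM [q [Mq nPq]]]] := minimal_prime_below_max.
apply: nPq; have [P0 [PD PMl]] := idP.
have [a ->] := modspanP (gen _ Mq).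
elim/big_ind: _ => // j _; apply: PMl.
have /PP[/PM MZ|//] : P (\det Z * gs`_j) by rewrite ann.
by case: M1; rewrite -(subrK (\det Z) 1); apply: MD.
Qed.

Lemma regular_of_edim1 : edim_le M 1 -> regular_at M.
Proof.
move=> ed; exists 1%N; split; last first.
  split=> // -[|r] // [x [_ H]]; case: maximal_not_idempotent => y /H[c [s [Hs ->]]].
  by exists s => //; rewrite big_ord0 add0r.
have [P mP sPM] := minimal_prime_below_max; split.
  exists (fun i => if i is 0 then P else M); split=> [[|[|i]] // _|].
  - by case: mP.
  - exact: maximal_prime.
  by split=> // -[|i].
move=> [c [pc [sc cM]]].
exact: (no_prime_chain dimR (pc 0%N isT) (pc 1%N isT) (pc 2 isT) (sc 0%N isT) (sc 1%N isT)).
Qed.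
End Regularity.

(** * Descent of forms and the theorem *)

Lemma lrmorphism_factor (k : fieldType) (A B C : comAlgType k)
    (pi : {lrmorphism A -> B}) (g : {lrmorphism A -> C}) :
  (forall b, exists a, pi a = b) -> (forall a, pi a = 0 -> g a = 0) ->
  exists f : {lrmorphism B -> C}, forall a, f (pi a) = g a.
Proof.
move=> surj ker; have [sec secP] := choice surj.
pose f b := g (sec b).
have fE a : f (pi a) = g a.
  apply/eqP; rewrite -subr_eq0 -rmorphB; apply/eqP/ker.
  by rewrite rmorphB /= secP subrr.
have fa : zmod_morphism f.
  by move=> x y; rewrite -(secP x) -(secP y) -rmorphB !fE rmorphB.
have fm : monoid_morphism f.
  split=> [|x y]; first by rewrite -(rmorph1 pi) fE rmorph1.
  by rewrite -(secP x) -(secP y) -rmorphM !fE rmorphM.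
have fs : scalable f.
  by move=> l x; rewrite -(secP x) -linearZ !fE linearZ.
pose m1 := GRing.isZmodMorphism.Build B C f fa.
pose m2 := GRing.isMonoidMorphism.Build B C f fm.
pose m3 := GRing.isScalable.Build k B C *:%R f fs.
pose F : {lrmorphism B -> C} := HB.pack f m1 m2 m3.
by exists F.
Qed.

Lemma finite_quotient (k : fieldType) (A B : comAlgType k) (pi : {lrmorphism A -> B})
    (U : A -> Prop) vs :
  (forall b, exists a, pi a = b) -> (forall a, U a -> pi a = 0) ->
  (forall a, inspan U vs a) -> finite_alg B.
Proof.
move=> surj ker fin; apply/finite_algP; exists (map pi vs) => b.
have [a <-] := surj b; have := fin a.
elim: (vs) a => [|v vs' IH] a /=; first by move=> /ker.
by move=> [l /IH]; rewrite linearB linearZ; exists l.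
Qed.

Lemma tame_char0 (k : fieldType) (B : comAlgType k) :
  [pchar k] =i pred0 -> PIA B -> tame_PIA B.
Proof. by move=> char0 PB; split=> // p; rewrite char0. Qed.

Section Descent.
Variables (k : fieldType) (R S : comAlgType k) (iota : {lrmorphism R -> S}).
Variables (c t : S) (N : nat).
Hypotheses (char0 : [pchar k] =i pred0).
Hypotheses (iota_inj : injective iota) (N0 : (0 < N)%N).
Hypotheses (fin_c : exists vs, forall s : S, inspan (multiples (c ^+ (N + N))) vs s).
Hypotheses (rad_t : forall y M, crad c y -> exists s w, y = s * t + c ^+ M * w)
  (tN : multiples (c ^+ 2) (t ^+ N)) (cR : forall s, exists r, c * s = iota r)
  (c1 : ~ multiples c 1).

Definition cond_ideal z := exists u w, z = u * t ^+ N + w * c ^+ (N + N).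
Definition cond_R r := cond_ideal (iota r).

Lemma cond_is_ideal : is_ideal cond_ideal.
Proof.
split; first by exists 0, 0; rewrite !mul0r addr0.
split=> [_ _ [u [w ->]] [u' [w' ->]]|a _ [u [w ->]]].
  by exists (u + u'), (w + w'); rewrite !mulrDl addrACA.
by exists (a * u), (a * w); rewrite mulrDr !mulrA.
Qed.

Lemma cond_R_ideal : is_ideal cond_R.
Proof.
have [I0 [ID IM]] := cond_is_ideal.
split; first by rewrite /cond_R rmorph0.
by split=> [x y|a x] *; rewrite /cond_R ?rmorphD ?rmorphM; [apply: ID|apply: IM].
Qed.

Lemma cond_sub z : cond_ideal z -> multiples (c ^+ 2) z.
Proof.
have [U0 [UD UM]] := multiples_ideal (c ^+ 2).
move=> [u [w ->]]; apply: UD; first exact: UM.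
apply: UM; exists (c ^+ (N + N - 2)); rewrite -exprD subnKC //.
by case: (N) N0 => // m _; rewrite addSn addnS.
Qed.

Lemma cond_in_R z : cond_ideal z -> exists2 r, cond_R r & z = iota r.
Proof.
move=> Iz; have [w E] := cond_sub Iz; have [r Er] := cR (c * w).
have zr : z = iota r by rewrite E expr2 -mulrA.
by exists r; rewrite // /cond_R -zr.
Qed.

Lemma cond_1 : ~ cond_ideal 1.
Proof. by move=> /cond_sub[w E]; apply: c1; exists (c * w); rewrite E expr2 mulrA. Qed.

(** As c lies in J, c = s t + c^(2N) w; its N-th power differs from (s t)^N by a multiple of
    c^(2N). *)
Lemma cond_cN : cond_ideal (c ^+ N).
Proof.
have [|s [w E]] := @rad_t c (N + N); first by exists 1%N, 1; rewrite expr1 mulr1.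
rewrite {1}E; set b := c ^+ _ * w.
have -> : (s * t + b) ^+ N = (s * t) ^+ N + b * \sum_(i < N) (s * t + b) ^+ (N.-1 - i) * (s * t) ^+ i.
  by rewrite -[LHS](subrK ((s * t) ^+ N)) addrC subrXX [s * t + b]addrC addrK.
set q := \sum_(i < N) _; exists (s ^+ N), (w * q).
by rewrite exprMn /b; congr (_ + _); ring.
Qed.

(* Write I for cond_ideal. Integrating forms in S / c^(2N) S puts I Omega_S inside
   dI + c^(2N) Omega_S up to d(c^(2N) S), and c^(2N) = c^N c^N with c^N in I, so that
   x y df = x d(y f) - x f dy with x, y, x f and y f all in I, hence in R. *)
Lemma cond_forms v : relform cond_ideal v ->
  exists2 w, relform cond_R w & v = opush iota w.
Proof.
have idI := cond_is_ideal; have idR := cond_R_ideal; have [I0 [ID IM]] := idI.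
pose E v := exists2 w, relform cond_R w & v = opush iota w.
have ED x y : E x -> E y -> E (x + y).
  move=> [w Hw ->] [w' Hw' ->]; exists (w + w'); first exact: relformD.
  by rewrite opushD.
have E0 : E 0.
  exists 0; first exact: relform0.
  by rewrite -[X in opush _ X](scale0r 0) opushZ rmorph0 scale0r.
have Edif z : cond_ideal z -> E (dif z).
  move=> /cond_in_R[r Ir ->]; exists (dif r); first exact: relform_dif.
  by rewrite opush_dif.
have Esq x y f : cond_ideal x -> cond_ideal y -> E ((x * y) *: dif f).
  move=> Ix Iy; have [a Ia xa] := cond_in_R Ix; have [b Ib yb] := cond_in_R Iy.
  have [|a' Ia' xfa] := @cond_in_R (x * f); first by rewrite mulrC; apply: IM.
  have [|b' _ yfb] := @cond_in_R (y * f); first by rewrite mulrC; apply: IM.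
  exists (a *: dif b' - a' *: dif b).
    by apply: relformD => //; [|apply: relformN => //]; apply: relform_coef.
  rewrite opushD opushN !opushZ !opush_dif -xa -yfb -xfa -yb difM scalerDr !scalerA.
  by rewrite addrK.
have Ec y f : E ((c ^+ (N + N) * y) *: dif f).
  have -> : c ^+ (N + N) * y = c ^+ N * (y * c ^+ N) by rewrite exprD; ring.
  by apply: Esq; [|apply: IM]; exact: cond_cN.
have Ecd y : E (dif (c ^+ (N + N) * y)).
  by apply: Edif; exists 0, y; rewrite mul0r add0r mulrC.
have Erel u : relform (multiples (c ^+ (N + N))) u -> E u.
  move=> [_ [s [[w ->] Hs ->]]]; apply: (ED); first exact: Ecd.
  rewrite /osum big_seq; elim/big_ind: _ => [|a b|p /Hs[y ->]]; [exact: E0|exact: ED|exact: Ec].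
have idc := multiples_ideal (c ^+ (N + N)).
have mc1 : ~ multiples (c ^+ (N + N)) 1.
  by move=> [a e]; apply: cond_1; exists 0, a; rewrite mul0r add0r mulrC -e.
(* Integration takes place in S/c^(2N) S, whose nilradical is generated by t; lifted to S, it is
   exact up to a relation of this quotient, which [Erel] absorbs. *)
have [B [pi [pi_surj pi_ker]]] := quotient_alg idc mc1.
have [vs Hvs] := fin_c.
have finB : finite_alg B by apply: (finite_quotient pi_surj _ Hvs) => a /pi_ker.
have pic : pi (c ^+ (N + N)) = 0 by apply/pi_ker; exists 1; rewrite mulr1.
have cpos : (N + N = (N + N).-1.+1)%N by case: (N) N0.
have nil_rad y : nilpotent_el (pi y) -> crad c y.
  move=> [n yn]; exists n; move: yn; rewrite -rmorphXn => /pi_ker[w ->].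
  by exists (c ^+ (N + N).-1 * w); rewrite {1}cpos exprS mulrA.
have t_nil : nilpotent_el (pi t).
  have [w E1] := tN; exists (N * (N + N))%N.
  rewrite exprM -!rmorphXn E1 exprMn -exprM mulnC exprM expr2 -mulrA.
  by rewrite rmorphM /= pic mul0r.
have t_gen y : nilpotent_el y -> exists z, y = z * pi t.
  have [x <-] := pi_surj y; move=> /nil_rad/rad_t-/(_ (N + N)%N)[s [w ->]].
  exists (pi s); rewrite rmorphD rmorphM /=.
  by have -> : pi (c ^+ (N + N) * w) = 0; [apply/pi_ker; exists w|rewrite addr0].
have Eform y f : cond_ideal y -> E (y *: dif f).
  move=> [u [w ->]]; rewrite scalerDl; apply: (ED); last by rewrite mulrC; apply: Ec.
  have [g Hg] := form_integration char0 finB t_nil t_gen N (pi u) (pi f).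
  have [v0 v0E] := pi_surj g.
  rewrite -(subrK (dif (t ^+ N * v0)) (_ *: _)); apply: (ED); last first.
    by apply: Edif; exists v0, 0; rewrite mul0r addr0 mulrC.
  apply: Erel; have [s sE] := osum_surj ((u * t ^+ N) *: dif f - dif (t ^+ N * v0)).
  rewrite sE; apply/(kd_null_quotient idc pi_surj pi_ker)/osum0.
  rewrite -opushE -sE opushD opushN opushZ !opush_dif !rmorphM rmorphXn /= v0E.
  by rewrite mulrC Hg subrr.
move=> [z [s [Iz Is ->]]]; apply: (ED); first exact: Edif.
rewrite /osum big_seq; elim/big_ind: _ => [|a b|p /Is]; [exact: E0|exact: ED|exact: Eform].
Qed.

Hypothesis omega_inj : forall s : seq (R * R), kd_null (dmap iota s) -> kd_null s.

(** The single test morphism R/I -> S/I, with tame target, detects every nonzero form of R/I. *)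
Lemma cond_quotient_principal (M : R -> Prop) : artinian_berger k ->
  (exists vs, forall r : R, inspan cond_R vs r) ->
  is_ideal M -> (forall x, cond_R x -> M x) ->
  exists2 m, M m & forall y, M y -> exists z, cond_R (y - z * m).
Proof.
move=> ABC [vsR HvsR] idM IM.
have idR := cond_R_ideal.
have R1 : ~ cond_R 1 by rewrite /cond_R rmorph1; exact: cond_1.
have [A [piA [surjA kerA]]] := quotient_alg idR R1.
have [B [piB [surjB kerB]]] := quotient_alg cond_is_ideal cond_1.
have finA : finite_alg A by apply: (finite_quotient surjA _ HvsR) => a /kerA.
have [vs Hvs] := fin_c.
have finB : finite_alg B.
  apply: (finite_quotient surjB _ Hvs) => _ [w ->]; apply/kerB.
  by exists 0, w; rewrite mul0r add0r mulrC.
have PB : PIA B.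
  apply: (PIA_nil finB (t := piB t)) => [|y].
    by exists N; rewrite -rmorphXn; apply/kerB; exists 1, 0; rewrite mul1r mul0r addr0.
  have [x <-] := surjB y; move=> [n]; rewrite -rmorphXn => /kerB/cond_sub[w E].
  have [|s [u ->]] := @rad_t x (N + N).
    by exists n, (c * w); rewrite E expr2 mulrA.
  exists (piB s); rewrite rmorphD rmorphM /=.
  have -> : piB (c ^+ (N + N) * u) = 0; last by rewrite addr0.
  by apply/kerB; exists 0, u; rewrite mul0r add0r mulrC.
have [f fE] := @lrmorphism_factor k R A B piA (piB \o iota) surjA
  (fun a Ha => (kerB (iota a)).2 ((kerA a).1 Ha)).
have tauA : tau_trivial A.
  move=> s Hs; have [sec secP] := choice surjA.
  pose s0 := [seq (sec p.1, sec p.2) | p <- s].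
  have sE : s = dmap piA s0.
    by rewrite /dmap /s0 -map_comp -[LHS]map_id; apply: eq_map => -[a b] /=; rewrite !secP.
  have := Hs B f (tame_char0 char0 PB).
  have -> : dmap f s = dmap piB (dmap iota s0).
    by rewrite sE /dmap -!map_comp; apply: eq_map => p /=; rewrite !fE.
  (* A form of R/I that dies in S/I lifts to a form of R whose image in Omega_S is a relation of I;
     [cond_forms] brings this relation back to R, where [omega_inj] identifies it with the lift. *)
  move/(kd_null_quotient cond_is_ideal surjB kerB)/cond_forms => [w Hw].
  have [s1 s1E] := osum_surj w; rewrite -opushE => E.
  rewrite sE; apply/(kd_null_quotient idR surjA kerA).
  suff -> : osum s0 = w by [].
  apply/eqP; rewrite -subr_eq0 s1E -osum_opp -osum_cat; apply/eqP/osum0/omega_inj/osum0.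
  by rewrite -opushE osum_cat opushD osum_opp opushN -s1E -E subrr.
have [_ PA] := ((ABC A finA).1 tauA).1.
have [M0 [MD MM]] := idM.
have idMA : is_ideal (fun y => exists2 m, M m & piA m = y).
  split; first by exists 0; rewrite ?rmorph0.
  split=> [_ _ [a Ma <-] [b Mb <-]|x _ [b Mb <-]].
    by exists (a + b); [exact: MD|rewrite rmorphD].
  have [a <-] := surjA x; exists (a * b); [exact: MM|by rewrite rmorphM].
have [g Hg] := PA _ idMA.
have [m Mm mg] : exists2 m, M m & piA m = g by apply/Hg; exists 1; rewrite mul1r.
exists m => // y My; have [z zE] : exists z, piA y = z * g by apply/Hg; exists y.
have [z0 z0E] := surjA z; exists z0; apply/kerA.
by rewrite rmorphB rmorphM /= z0E mg zE subrr.
Qed.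
End Descent.

Theorem theorem0p1 (k : fieldType) (char0 : [pchar k] =i pred0) :
  artinian_berger k ->
  forall R : comAlgType k,
    reduced R -> fin_gen R -> pure_dim_one R -> ~ regular_ring R ->
    omega_torsion_nonzero R.
Proof.
move=> ABC R redR fgR dimR nreg; apply: contrapT => notor.
apply: nreg => M maxM; apply: regular_of_edim1 => //.
  have [x int] := noether_normalization dimR fgR.
  have [p p0 Mp] := maximal_poly dimR maxM int.
  have [vs Hvs] := poly_quotient_finite fgR int p0.
  by exists (horner_alg x p), vs.
have {}notor (s : seq (R * R)) (r : R) : nonzerodivisor r -> kd_null (dscale r s) -> kd_null s.
  by move=> nr ns; apply: contrapT => H; apply: notor; exists s; split=> //; exists r.
have [x int] := noether_normalization dimR fgR.
pose h : {rmorphism {poly k} -> R} := horner_alg x.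
have tf p y : p != 0 -> h p * y = 0 -> y = 0 by apply: poly_torsion_free.
have [n [r [span_r ind_r]]] := poly_basis redR dimR fgR int.
pose d := disc (h := h) span_r.
have d0 : d != 0 by apply: disc_neq0 => //; exact: int.
have disc_d e z : e != 0 -> almost_int h e z -> exists w, h d * z = h e * w.
  exact: almost_int_disc.
have [S [iota [rho clS]]] := integral_closure_exists tf d0 disc_d.
have [p p0 Mp] := maximal_poly dimR maxM int.
have q0 : d * p != 0 by rewrite mulf_neq0.
have finR := poly_quotient_finite fgR int.
have finS q : q != 0 -> exists vs, forall s, inspan (multiples (iota (h q))) vs s.
  exact: (closure_finite clS d0).
pose c := iota (h (d * p)).
have [vs Hvs] := finS _ q0.
have cancel_c a b : c * a = c * b -> a = b by apply: (closure_cancel clS d0).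
have closed_c J a : is_ideal J -> J c ->
    (forall j, J j -> exists2 j', J j' & a * j = c * j') -> multiples c a.
  exact: (closure_multiplier clS d0).
have [t [m [w mw]] Ht] := rad_uniformizer Hvs cancel_c closed_c.
have ii : injective iota by apply: (iota_inj clS d0).
have cE s : c * s = iota (h p * rho s).
  by rewrite [RHS]rmorphM /= (iota_rho clS d0) // /c !rmorphM /=; ring.
(* As t^m is a multiple of c, t^(2m) is a multiple of c^2; the [.+2] makes N positive for every
   m. *)
pose N := (m + m).+2.
have cX : c ^+ (N + N) = iota (h ((d * p) ^+ (N + N))) by rewrite /c !rmorphXn.
have X0 : (d * p) ^+ (N + N) != 0 by rewrite expf_neq0.
have [[M0 [MD MM]] [M1 _]] := maxM.
have tN : multiples (c ^+ 2) (t ^+ N).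
  by exists (w ^+ 2 * t ^+ 2); rewrite /N -addn2 !exprD mw; ring.
have c1 : ~ multiples c 1.
  move=> [s]; rewrite cE -(rmorph1 iota) => /ii E; apply: M1.
  by rewrite E mulrC; apply: MM.
(* One c turns s into h p * rho s by [cE], the other is h d * h p, so two factors h p come out. *)
have c2M a : multiples (c ^+ 2) (iota a) -> exists b, a = h p * (h p * b).
  move=> [s E]; exists (h d * rho s); apply: ii.
  by rewrite E expr2 -mulrA [c * s]cE /c -(rmorphM iota) (rmorphM h); congr (iota _); ring.
have finc : exists vs, forall s : S, inspan (multiples (c ^+ (N + N))) vs s.
  by rewrite cX; apply: finS.
have cR s : exists r, c * s = iota r by exists (h p * rho s).
have Isub z : cond_ideal c t N z -> multiples (c ^+ 2) z by apply: cond_sub.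
have finI : exists vs, forall r : R, inspan (cond_R iota c t N) vs r.
  have [us Hus] := finR _ X0; exists us => a; apply: inspan_mono (Hus a) => _ [b ->].
  by exists 0, (iota b); rewrite mul0r add0r cX rmorphM mulrC.
have IM a : cond_R iota c t N a -> M a.
  by move=> /Isub/c2M[b ->]; rewrite mulrC; apply: (MM).
have oi : forall s : seq (R * R), kd_null (dmap iota s) -> kd_null s.
  exact: (omega_closure_inj clS d0).
have [g Mg Hg] : exists2 m, M m & forall y, M y -> exists z, cond_R iota c t N (y - z * m).
  exact: cond_quotient_principal.
exists (fun=> g); split=> // y /Hg[z /Isub/c2M[b E]].
(* The part in M^2 is a single product, both of whose factors are multiples of h p. *)
exists (fun=> z), [:: (h p, h p * b)]; split.
  by move=> q; rewrite inE => /eqP -> /=; split=> //; rewrite mulrC; apply: (MM).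
by rewrite big_ord_recl big_ord0 big_seq1 /= addr0 -E addrC subrK.
Qed.
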